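(* Let $\alpha,\beta,M_f,M_V>0$. Consider the regression model $y_i=f(x_i)+V^{1/2}(x_i)z_i$, $i=1,\ldots,n$, where $x_i=i/n$ and the $z_i$ are independent random variables with zero mean, unit variance and uniformly bounded fourth moments. Let $\widehat V$ be the first-order-difference kernel estimator $$\widehat V(x)=\tfrac12\sum_{i=1}^{n-1}K_i^h(x)\,(y_i-y_{i+1})^2,\qquad x\in[0,1],$$ with weights $K_i^h$ as defined in the context and with bandwidth $h=h_n\in(0,1/2)$ satisfying $h=O(n^{-1/(1+2\beta)})$, where $O$ is understood as exact order (that is, $h_n\,n^{1/(1+2\beta)}$ stays bounded away from $0$ and $\infty$). Then there exists some constant $C_0>0$ depending only on $\alpha$, $\beta$, $M_f$ and $M_V$ such that for all sufficiently large $n$, $$\sup_{f\in\Lambda^\alpha(M_f),\,V\in\Lambda^\beta(M_V)}\ \sup_{0\le x_*\le 1}E\big(\widehat V(x_* )-V(x_* )\big)^2\le C_0\cdot\max\{n^{-4\alpha},n^{-2\beta/(1+2\beta)}\}$$ and $$\sup_{f\in\Lambda^\alpha(M_f),\,V\in\Lambda^\beta(M_V)}E\int_0^1\big(\widehat V(x)-V(x)\big)^2\,dx\le C_0\cdot\max\{n^{-4\alpha},n^{-2\beta/(1+2\beta)}\}.$$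
   Context: The mean function $f$ and the variance function $V$ (nonnegative, so that $V^{1/2}$ makes sense) are defined on $[0,1]$ and unknown; $E$ denotes expectation under the model with the given $f$ and $V$. Lipschitz class. For $\alpha>0$, $M>0$, let $\lfloor\alpha\rfloor$ denote the largest integer (strictly) less than $\alpha$ and $\alpha'=\alpha-\lfloor\alpha\rfloor$. Then $\Lambda^\alpha(M)$ is the set of functions $g$ on $[0,1]$ such that for all $0\le x,y\le1$ and $k=0,\ldots,\lfloor\alpha\rfloor-1$, $|g^{(k)}(x)|\le M$ and $|g^{(\lfloor\alpha\rfloor)}(x)-g^{(\lfloor\alpha\rfloor)}(y)|\le M|x-y|^{\alpha'}$. Kernels. $K$ is a kernel function supported on $[-1,1]$ with $\int_{-1}^1K(x)\,dx=1$, $\int_{-1}^1K(x)x^i\,dx=0$ for $i=1,\ldots,\lfloor\beta\rfloor$, and $\int_{-1}^1K^2(x)\,dx<\infty$. For each $t\in[0,1]$, $K_t$ is a boundary kernel function supported on $[-1,t]$ with $\int_{-1}^tK_t(x)\,dx=1$, $\int_{-1}^tK_t(x)x^i\,dx=0$ for $i=1,\ldots,\lfloor\beta\rfloor$, and $\int_{-1}^tK_t^2(x)\,dx\le\widehat k$ for all $t\in[0,1]$, where $\widehat k<\infty$ does not depend on $t$. Weights. For $0<h<1/2$, $x\in[0,1]$ and $i=1,\ldots,n-1$, let $I_i=[(x_{i-1}+x_i)/2,(x_i+x_{i+1})/2]$ for $2\le i\le n-2$, $I_1=[0,(x_1+x_2)/2]$ and $I_{n-1}=[(x_{n-2}+x_{n-1})/2,1]$.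 Then $$K_i^h(x)=\begin{cases}\int_{I_i}\frac1hK\left(\frac{x-u}{h}\right)du,& x\in(h,1-h),\\[2pt] \int_{I_i}\frac1hK_t\left(\frac{x-u}{h}\right)du,& x=th\text{ for some }t\in[0,1],\\[2pt] \int_{I_i}\frac1hK_t\left(-\frac{x-u}{h}\right)du,& x=1-th\text{ for some }t\in[0,1].\end{cases}$$
   Formalization: For β≤1 the bound V≤M_V on [0,1] is added (else constants V=c make the supremum infinite), and C_0 may also depend on the bounds for ∫K² and ∫K_t², the fourth-moment bound and the two constants bounding h_n n^{1/(1+2β)}; kernels are assumed (jointly) measurable. *)

(* Defs.v *)
From HB Require Import structures.
From mathcomp Require Export all_boot all_order all_algebra.
From mathcomp Require Export all_classical all_reals all_analysis.
Export Order.TTheory GRing.Theory Num.Theory.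
Export numFieldNormedType.Exports.

Set Implicit Arguments.
Unset Strict Implicit.
Unset Printing Implicit Defensive.

Local Open Scope classical_set_scope.
Local Open Scope ring_scope.

(* Functions on [0,1] are represented by functions on R: for design points in
   [0,1] and bandwidths in (0,1/2), nothing below depends on f or V outside
   [0,1], or on the boundary kernels K_t for t outside [0,1]. *)

(* The largest integer strictly less than a; it is >= 0 when a > 0, so that the
   absolute value only converts int to nat. *)
Definition sfloor (R : realType) (a : R) : nat := `|Num.ceil a - 1|%N.

(* Difference quotients are taken over y in [0,1] only, hence one-sided at 0
   and 1. *)
Definition diff_quot01 (R : realType) (g : R -> R) (x : R) :=
  (g y - g x) / (y - x) @[y --> within `[0, 1]%classic x^'].

Definition derivable01 (R : realType) (g : R -> R) : Prop :=
  forall x : R, x \in `[0, 1] -> cvg (diff_quot01 g x).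

Definition derive01 (R : realType) (g : R -> R) (x : R) : R :=
  lim (diff_quot01 g x).

Definition lipschitz_class (R : realType) (a M : R) : set (R -> R) :=
  [set g | [/\ forall k, (k < sfloor a)%N ->
                 derivable01 (iter k (@derive01 R) g),
               forall k, (k < sfloor a)%N -> forall x : R, x \in `[0, 1] ->
                 `|iter k (@derive01 R) g x| <= M
             & forall x y : R, x \in `[0, 1] -> y \in `[0, 1] ->
                 `|iter (sfloor a) (@derive01 R) g x
                   - iter (sfloor a) (@derive01 R) g y|
                 <= M * `|x - y| `^ (a - (sfloor a)%:R)]].

(* Variance functions.  For b > 1 the class lipschitz_class b M already bounds
   V by M.  For b <= 1 it bounds only the increments of V, so it contains all
   nonnegative constants and no uniform risk bound can hold over it; there, the
   bound V <= M is added. *)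
Definition variance_class (R : realType) (b M : R) : set (R -> R) :=
  [set V | [/\ lipschitz_class b M V,
               forall x : R, x \in `[0, 1] -> 0 <= V x
             & b <= 1 -> forall x : R, x \in `[0, 1] -> V x <= M]].

(* The constant kK bounds the squared L^2 norm of K. *)
Definition is_kernel (R : realType) (b kK : R) (K : R -> R) : Prop :=
  [/\ measurable_fun setT K,
      forall x : R, x \notin `[-1, 1] -> K x = 0,
      \int[lebesgue_measure]_(x in `[-1, 1]) K x = 1,
      forall i, (1 <= i <= sfloor b)%N ->
        \int[lebesgue_measure]_(x in `[-1, 1]) (K x * x ^+ i) = 0
    & (\int[lebesgue_measure]_(x in `[(-1)%R, 1%R]) ((K x) ^+ 2)%:E <= kK%:E)%E].

(* Joint measurability in (t, x) makes the integral over [0,1] of the squared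
   error of the estimator meaningful. *)
Definition is_boundary_kernel (R : realType) (b khat : R) (Kt : R -> R -> R)
    : Prop :=
  measurable_fun ((`[0, 1]%classic : set R) `*` [set: R])
    (fun p : R * R => Kt p.1 p.2) /\
  forall t : R, t \in `[0, 1] ->
  [/\ forall x : R, x \notin `[-1, t] -> Kt t x = 0,
      \int[lebesgue_measure]_(x in `[-1, t]) Kt t x = 1,
      forall i, (1 <= i <= sfloor b)%N ->
        \int[lebesgue_measure]_(x in `[-1, t]) (Kt t x * x ^+ i) = 0
    & (\int[lebesgue_measure]_(x in `[(-1)%R, t]) ((Kt t x) ^+ 2)%:E
         <= khat%:E)%E].

Definition design (R : realType) (n i : nat) : R := i%:R / n%:R.

Definition cell (R : realType) (n i : nat) : set R :=
  `[ (if i == 1%N then 0 else (design R n i.-1 + design R n i) / 2),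
     (if i == n.-1 then 1 else (design R n i + design R n i.+1) / 2) ]%classic.

(* The last two cases are x = t h and x = 1 - t h with t in [0,1]. *)
Definition weight (R : realType) (K : R -> R) (Kt : R -> R -> R) (h : R)
    (n i : nat) (x : R) : R :=
  if h < x < 1 - h then
    \int[lebesgue_measure]_(u in @cell R n i) (h^-1 * K ((x - u) / h))
  else if x <= h then
    \int[lebesgue_measure]_(u in @cell R n i) (h^-1 * Kt (x / h) ((x - u) / h))
  else
    \int[lebesgue_measure]_(u in @cell R n i)
      (h^-1 * Kt ((1 - x) / h) (- ((x - u) / h))).

Definition obs (R : realType) (T : Type) (f V : R -> R) (z : nat -> T -> R)
    (n i : nat) (w : T) : R :=
  f (design R n i) + Num.sqrt (V (design R n i)) * z i w.

Definition Vhat (R : realType) (K : R -> R) (Kt : R -> R -> R) (h : R) (n : nat)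
    (T : Type) (y : nat -> T -> R) (x : R) (w : T) : R :=
  2^-1 * \sum_(1 <= i < n) weight K Kt h n i x * (y i w - y i.+1 w) ^+ 2.

Definition independent_RVs (d : measure_display) (T : measurableType d)
    (R : realType) (P : probability T R) (I : finType) (X : I -> T -> R) : Prop :=
  forall (J : {set I}) (B : I -> set R), (forall i, measurable (B i)) ->
    P (\bigcap_(i in [set` J]) (X i @^-1` B i))
    = (\prod_(i in J) P (X i @^-1` B i))%E.

Definition noise (d : measure_display) (T : measurableType d) (R : realType)
    (P : probability T R) (m4 : R) (n : nat) (z : nat -> {RV P >-> R}) : Prop :=
  independent_RVs P (fun i : 'I_n => (z i.+1 : T -> R)) /\
  forall i, (1 <= i <= n)%N ->
    [/\ ('E_P[z i] = 0)%E, ('V_P[z i] = 1)%E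
      & ('E_P[fun w => ((z i w) ^+ 4)%R] <= m4%:E)%E].

Definition pointwise_risk (d : measure_display) (T : measurableType d)
    (R : realType) (P : probability T R) (z : nat -> {RV P >-> R})
    (K : R -> R) (Kt : R -> R -> R) (h : R) (n : nat) (f V : R -> R) (x : R)
    : \bar R :=
  ('E_P[fun w => ((Vhat K Kt h n (obs f V z n) x w - V x) ^+ 2)%R])%E.

Definition integrated_risk (d : measure_display) (T : measurableType d)
    (R : realType) (P : probability T R) (z : nat -> {RV P >-> R})
    (K : R -> R) (Kt : R -> R -> R) (h : R) (n : nat) (f V : R -> R)
    : \bar R :=
  (\int[P]_w \int[lebesgue_measure]_(x in `[0%R, 1%R])
     ((Vhat K Kt h n (obs f V z n) x w - V x) ^+ 2)%:E)%E.

Definition rate (R : realType) (a b : R) (n : nat) : R :=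
  Num.max (n%:R `^ (- (4 * a))) (n%:R `^ (- (2 * b / (1 + 2 * b)))).

(* Main.v *)
Require Import Defs.
From mathcomp Require Import measurable_realfun ring lra zify.

Set Implicit Arguments.
Unset Strict Implicit.
Unset Printing Implicit Defensive.

Local Open Scope classical_set_scope.
Local Open Scope ring_scope.

(** With x_i = i/n and delta_i = f(x_i) - f(x_{i+1}), the squared difference
    (y_i - y_{i+1})^2 has mean delta_i^2 + V(x_i) + V(x_{i+1}), so that at a
    fixed point x

      Vhat(x) - V(x) = b(x) + (1/2) sum_i K_i(x) U_i

    with b(x) deterministic and U_i centred.

    Bias: delta_i^2 is O(n^{-2 min(alpha,1)}); replacing V(x_i), V(x_{i+1}) by V
    on the i-th cell costs O(n^{-min(beta,1)}); Taylor's formula and the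
    vanishing moments of the kernel leave O(h^beta).  When alpha or beta
    exceeds 1 the exponents capped at 1 are still dominated by
    n^{-2 beta/(1+2 beta)}, since 2 beta/(1+2 beta) < 1.

    Variance: U_i is a combination of z_i, z_{i+1}, z_i^2 - 1, z_{i+1}^2 - 1 and
    z_i z_{i+1}.  Each of these five families is orthogonal in i, hence the
    second moment of the sum is O(sum_i K_i(x)^2), and Cauchy-Schwarz on each
    cell bounds sum_i K_i(x)^2 by O(1/(n h)).

    The integrated risk is the integral of the pointwise risk, by Tonelli. *)

(** * Products of independent variables *)

(** The $U_i$ themselves are in general not orthogonal: $U_i$ and $U_{i+1}$ share $z_{i+1}$. Within
    each of the five families, a product of two distinct members contains a centred factor
    independent of the others, so its mean vanishes; the families are recombined by a crude
    inequality, without computing cross moments. Independence is given as a product formula for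
    events, so the product rule for expectations, with factors of any sign, is derived from it.

    The weights may be negative and the kernels are controlled in $L^2$ only. An $L^1$ bound free of
    $h$ and $x$ follows because a rescaled kernel lives on an interval of length $2h$; it serves the
    bias, the $L^2$ bound serves the variance. Interior and boundary kernels share one interface
    around $x$, so each estimate is made once and is uniform in $x$.

    The term $n^{-4\alpha}$ is the square of the bias $\delta_i^2$ when $\alpha\le1$. The two sides
    of the exact-order condition on $h$ act separately: the upper one on $h^{2\beta}$, the lower one
    on $1/(nh)$. *)

Section indep.
Import HBNNSimple.
Context d (T : measurableType d) (R : realType) (P : probability T R).
Local Open Scope ereal_scope.

(** Factorization against indicators of events in [X] passes to simple functions by linearity and to
    [g] by monotone convergence. [Phi] is arbitrary because in the induction below it is a product
    of the other factors with an indicator. *)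
Lemma ge0_integralM_indep (Phi X : T -> R) (g : R -> R) :
  measurable_fun setT Phi -> measurable_fun setT X -> measurable_fun setT g ->
  (forall w, 0 <= Phi w)%R -> (forall r, 0 <= g r)%R ->
  \int[P]_w (Phi w)%:E < +oo ->
  (forall B, measurable B -> \int[P]_w (Phi w * \1_(X @^-1` B) w)%:E
      = \int[P]_w (Phi w)%:E * P (X @^-1` B)) ->
  \int[P]_w (Phi w * g (X w))%:E
    = \int[P]_w (Phi w)%:E * \int[P]_w (g (X w))%:E.
Proof.
move=> mPhi mX mg Phi0 g0 Phifin PhiX.
have IPhi0 : 0 <= \int[P]_w (Phi w)%:E by apply: integral_ge0 => w _; rewrite lee_fin.
have Phifn : \int[P]_w (Phi w)%:E \is a fin_num by rewrite ge0_fin_numE.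
have mg' : @measurable_fun _ _ R (\bar R) setT (EFin \o g) by exact/measurable_EFinP.
pose h := nnsfun_approx measurableT mg'.
have hg r : (h n r)%:E @[n --> \oo] --> (g r)%:E.
  by apply: (cvg_nnsfun_approx measurableT mg') => // x _; rewrite lee_fin.
have mhX n : measurable_fun setT (fun w => h n (X w)) by exact: measurableT_comp.
have ndh r a b : (a <= b)%N -> (h a r <= h b r)%R.
  by move=> ab; exact/lefP/nd_nnsfun_approx.
have E1 : \int[P]_w (g (X w))%:E = limn (fun n => \int[P]_w (h n (X w))%:E).
  rewrite -monotone_convergence//.
  - by apply: eq_integral => w _; apply/esym/cvg_lim => //; exact: hg.
  - by move=> n; exact/measurable_EFinP.
  - by move=> n w _; rewrite lee_fin.
  - by move=> w _ a b ab; rewrite lee_fin ndh.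
have E2 : \int[P]_w (Phi w * g (X w))%:E
  = limn (fun n => \int[P]_w (Phi w * h n (X w))%:E).
  rewrite -monotone_convergence//.
  - apply: eq_integral => w _; apply/esym/cvg_lim => //.
    under eq_fun do rewrite EFinM; rewrite EFinM.
    by apply: cvgeZl => //; exact: hg.
  - by move=> n; apply/measurable_EFinP; exact: measurable_funM.
  - by move=> n w _; rewrite lee_fin mulr_ge0.
  - by move=> w _ a b ab; rewrite lee_fin ler_wpM2l ?ndh.
have key n : \int[P]_w (Phi w * h n (X w))%:E
  = \int[P]_w (Phi w)%:E * \int[P]_w (h n (X w))%:E.
  have mI r : measurable (X @^-1` (h n @^-1` [set r])).
    rewrite -[X in measurable X]setTI; apply: mX => //.
  have hE w : h n (X w) = (\sum_(r \in range (h n)) r *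
    \1_(X @^-1` (h n @^-1` [set r])) w)%R.
    by rewrite fimfunE.
  have mInd r : measurable_fun setT (\1_(X @^-1` (h n @^-1` [set r])) : T -> R)
    by exact: measurable_indic.
  transitivity (\int[P]_w (\sum_(r \in range (h n))
    (r * (Phi w * \1_(X @^-1` (h n @^-1` [set r])) w))%:E)).
    apply: eq_integral => w _; rewrite hE fsumEFin//; congr EFin.
    rewrite mulrC mulr_fsuml; apply: eq_fsbigr => r _.
    by rewrite mulrAC -mulrA.
  rewrite ge0_integral_fsum//; last 2 first.
  - move=> r; apply/measurable_EFinP; apply: measurable_funM => //.
    exact: measurable_funM.
  - move=> r w _; rewrite lee_fin mulrCA mulr_ge0// /indic.
    case: (boolP (w \in _)) => [/set_mem/= <-|_]; first by rewrite mulr1.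
    by rewrite mulr0.
  transitivity (\sum_(r \in range (h n))
    (\int[P]_w (Phi w)%:E * (r%:E * P (X @^-1` (h n @^-1` [set r]))))).
    apply: eq_fsbigr => r /set_mem [y _ <-].
    under eq_integral do rewrite EFinM.
    rewrite ge0_integralZl//; last 3 first.
    - by apply/measurable_EFinP; exact: measurable_funM.
    - by move=> w _; rewrite lee_fin mulr_ge0.
    - by rewrite lee_fin.
    by rewrite PhiX// muleCA.
  (* Every term is nonnegative: a nonempty level set contains some [w] with [r = h n (X w)], and an
     empty one has measure zero. *)
  rewrite -ge0_mule_fsumr; last first.
    move=> r; have [->|] := eqVneq (X @^-1` (h n @^-1` [set r])) set0.
      by rewrite measure0 mule0.
    by move=> /set0P[w /= <-]; rewrite mule_ge0// lee_fin.
  congr (_ * _).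
  transitivity (\int[P]_w (\sum_(r \in range (h n))
    (r * \1_(X @^-1` (h n @^-1` [set r])) w)%:E)); last first.
    by apply: eq_integral => w _; rewrite hE fsumEFin.
  rewrite ge0_integral_fsum//; last 2 first.
  - by move=> r; apply/measurable_EFinP; apply: measurable_funM.
  - move=> r w _; rewrite lee_fin /indic.
    case: (boolP (w \in _)) => [/set_mem/= <-|_]; first by rewrite mulr1.
    by rewrite mulr0.
  apply: eq_fsbigr => r /set_mem [y _ <-].
  under eq_integral do rewrite EFinM.
  rewrite ge0_integralZl//.
  - by rewrite integral_indic// setIT.
  - exact/measurable_EFinP.
  - by rewrite lee_fin.
rewrite E1 E2.
under eq_fun do rewrite key.
apply/cvg_lim => //; apply: cvgeZl => //.
apply: ereal_nondecreasing_is_cvgn => a b ab.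
apply: ge0_le_integral => //.
- by move=> w _; rewrite lee_fin.
- by exact/measurable_EFinP.
- by exact/measurable_EFinP.
- by move=> w _; rewrite lee_fin ndh.
Qed.

Section product.
Context (I : finType) (X : I -> T -> R).
Hypothesis mX : forall i, measurable_fun setT (X i).
Hypothesis indX : independent_RVs P X.

Let measurable_prodX (s : seq I) (g : I -> R -> R) :
  (forall i, measurable_fun setT (g i)) ->
  measurable_fun setT (fun w => \prod_(i <- s) g i (X i w))%R.
Proof.
by move=> mg; apply: measurable_prod => i _; exact: measurableT_comp.
Qed.

(** The indicator of events on indices outside [s] strengthens the induction. To add the factor
    [g i], the previous lemma asks for factorization against events in [X i]; that is the induction
    hypothesis with [i] moved into [J]. *)
Lemma ge0_integral_prod_indic_indep (s : seq I) (g : I -> R -> R) : uniq s ->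
  (forall i, measurable_fun setT (g i)) ->
  (forall i r, i \in s -> 0 <= g i r)%R ->
  (forall i, i \in s -> \int[P]_w (g i (X i w))%:E < +oo) ->
  forall (J : {set I}) (B : I -> set R), (forall i, measurable (B i)) ->
  (forall i, i \in s -> i \notin J) ->
  \int[P]_w (\prod_(i <- s) g i (X i w) *
             \1_(\bigcap_(i in [set` J]) (X i @^-1` B i)) w)%:E
  = \prod_(i <- s) \int[P]_w (g i (X i w))%:E * \prod_(i in J) P (X i @^-1` B i).
Proof.
move=> + mg; elim: s => [|i s IH] /=.
  move=> _ g0 gfin J B mB _.
  under eq_integral do rewrite big_nil mul1r.
  rewrite big_nil mul1e integral_indic//; first by rewrite setIT; exact: indX.
  apply: fin_bigcap_measurable => //= j _.
  by rewrite -[X in measurable X]setTI; exact: mX.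
move=> /andP[iNs us] g0 gfin J B mB sJ.
have g0' j r : j \in s -> (0 <= g j r)%R by move=> js; rewrite g0// inE js orbT.
have gfin' j : j \in s -> \int[P]_w (g j (X j w))%:E < +oo.
  by move=> js; rewrite gfin// inE js orbT.
have sJ' j : j \in s -> j \notin J by move=> js; rewrite sJ// inE js orbT.
have iJ : i \notin J by rewrite sJ// mem_head.
have {}IH := IH us g0' gfin'.
have mcap (J' : {set I}) B' : (forall j, measurable (B' j)) ->
    measurable (\bigcap_(j in [set` J']) (X j @^-1` B' j)).
  move=> mB'; apply: fin_bigcap_measurable => //= j _.
  by rewrite -[X in measurable X]setTI; exact: mX.
pose Phi w := (\prod_(j <- s) g j (X j w) *
  \1_(\bigcap_(j in [set` J]) (X j @^-1` B j)) w)%R.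
have fP j : P (X j @^-1` B j) \is a fin_num.
  apply: fin_num_measure; rewrite -[X in measurable X]setTI; exact: mX.
have Ig0 j : j \in s -> 0 <= \int[P]_w (g j (X j w))%:E.
  by move=> js; apply: integral_ge0 => w _; rewrite lee_fin g0'.
have Phifin : \int[P]_w (Phi w)%:E \is a fin_num.
  rewrite /Phi IH// fin_numM//.
    rewrite big_seq; elim/big_ind : _ => // [x y|j js]; first exact: fin_numM.
    by rewrite ge0_fin_numE ?gfin' ?Ig0.
  by elim/big_ind : _ => // x y; exact: fin_numM.
have Phi0 w : (0 <= Phi w)%R.
  by rewrite mulr_ge0// big_seq prodr_ge0// => j js; rewrite g0'.
transitivity (\int[P]_w (Phi w * g i (X i w))%:E).
  by apply: eq_integral => w _; rewrite big_cons /Phi -mulrA mulrC.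
rewrite ge0_integralM_indep//.
- by rewrite /Phi IH// big_cons muleAC; congr (_ * _); rewrite muleC.
- by apply: measurable_funM; [exact: measurable_prodX|exact/measurable_indic/mcap].
- by move=> r; rewrite g0// mem_head.
- by rewrite -ge0_fin_numE// integral_ge0// => w _; rewrite lee_fin.
- move=> B0 mB0.
  pose B' j := if j == i then B0 else B j.
  have mB' j : measurable (B' j) by rewrite /B'; case: ifP.
  transitivity (\int[P]_w (\prod_(j <- s) g j (X j w) *
      \1_(\bigcap_(j in [set` (i |: J)%SET]) (X j @^-1` B' j)) w)%:E).
    apply: eq_integral => w _; congr EFin; rewrite /Phi -mulrA; congr (_ * _)%R.
    rewrite !indicE -natrM mulnb -in_setI; congr (_ (_ \in _))%:R.
    apply/seteqP; split => x /=.
      move=> [xJ xB0] j /=; rewrite !inE /B' => /orP[/eqP ->|jJ].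
        by rewrite eqxx.
      by case: eqP => [->//|_]; exact: xJ.
    move=> H; split.
      move=> j jJ; have := H j; rewrite /= !inE /B'.
      by case: eqP => [ji|_]; [move: iJ jJ; rewrite -ji /= => /negbTE ->|apply;
        rewrite jJ].
    by have := H i; rewrite /= !inE /B' eqxx; exact.
  rewrite IH//; last first.
    move=> j js; rewrite !inE negb_or sJ'// andbT.
    by apply: contraNneq iNs => <-.
  rewrite /Phi IH// -muleA; congr (_ * _).
  rewrite big_setU1//= {1}/B' eqxx muleC; congr (_ * _).
  apply: eq_bigr => j jJ; rewrite /B'; case: eqP => // ji.
  by move: iJ; rewrite -ji jJ.
Qed.

Lemma ge0_integral_prod_indep (s : seq I) (g : I -> R -> R) : uniq s ->
  (forall i, measurable_fun setT (g i)) ->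
  (forall i r, i \in s -> 0 <= g i r)%R ->
  (forall i, i \in s -> \int[P]_w (g i (X i w))%:E < +oo) ->
  \int[P]_w (\prod_(i <- s) g i (X i w))%:E
  = \prod_(i <- s) \int[P]_w (g i (X i w))%:E.
Proof.
move=> us mg g0 gfin.
have := ge0_integral_prod_indic_indep us mg g0 gfin (J := finset.set0)
  (B := fun=> setT) (fun=> measurableT).
rewrite big_set0 mule1 => <-; last by move=> i _; rewrite inE.
apply: eq_integral => w _; rewrite [X in \1_X](_ : _ = setT) ?indicT ?mulr1//.
by apply/seteqP; split.
Qed.

Lemma integral_prod_indep (s : seq I) (g : I -> R -> R) : uniq s ->
  (forall i, measurable_fun setT (g i)) ->
  (forall i, i \in s -> P.-integrable setT (fun w => (g i (X i w))%:E)) ->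
  P.-integrable setT (fun w => (\prod_(i <- s) g i (X i w))%:E) /\
  \int[P]_w (\prod_(i <- s) g i (X i w))%:E
  = \prod_(i <- s) \int[P]_w (g i (X i w))%:E.
Proof.
move=> us; suff H (s1 : seq I) : forall g : I -> R -> R,
    (forall i, measurable_fun setT (g i)) ->
    (forall i, i \in s -> P.-integrable setT (fun w => (g i (X i w))%:E)) ->
    (forall i r, i \in s -> i \notin s1 -> 0 <= g i r)%R ->
    P.-integrable setT (fun w => (\prod_(i <- s) g i (X i w))%:E) /\
    \int[P]_w (\prod_(i <- s) g i (X i w))%:E
    = \prod_(i <- s) \int[P]_w (g i (X i w))%:E.
  by move=> mg ig; apply: (H s) => // i r ->.
(* s1 lists the indices whose factor may change sign; they are treated one at a
   time by splitting g k into its positive and negative parts. *)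
elim: s1 => [|k s1 IH] {}g mg ig g0.
  have E : \int[P]_w (\prod_(i <- s) g i (X i w))%:E
      = \prod_(i <- s) \int[P]_w (g i (X i w))%:E.
    apply: ge0_integral_prod_indep => //.
    - by move=> i r si; rewrite g0.
    - by move=> i si; apply: integrable_lty => //; exact: ig.
  split=> //; apply/integrableP; split; first exact/measurable_EFinP/measurable_prodX.
  under eq_integral => w _.
    rewrite gee0_abs; last first.
      by rewrite lee_fin big_seq prodr_ge0// => j js; rewrite g0.
    over.
  rewrite E -ge0_fin_numE; last first.
    rewrite big_seq; elim/big_ind : _ => // [x y|j js]; first exact: mule_ge0.
    by apply: integral_ge0 => w _; rewrite lee_fin g0.
  rewrite big_seq; elim/big_ind : _ => // [x y|j js]; first exact: fin_numM.
  by apply: integrable_fin_num => //; exact: ig.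
have [ks|ks] := boolP (k \in s); last first.
  apply: IH => // i r si is1; rewrite g0// inE negb_or is1 andbT.
  by apply: contraNneq ks => <-.
pose gp j := if j == k then (g k)^\+%R else g j.
pose gn j := if j == k then (g k)^\-%R else g j.
have ipk : P.-integrable setT (fun w => ((g k)^\+%R (X k w))%:E).
  exact: (integrable_funrpos measurableT (ig k ks)).
have ink : P.-integrable setT (fun w => ((g k)^\-%R (X k w))%:E).
  exact: (integrable_funrneg measurableT (ig k ks)).
have [ip Ep] : P.-integrable setT (fun w => (\prod_(i <- s) gp i (X i w))%:E) /\
    \int[P]_w (\prod_(i <- s) gp i (X i w))%:E
    = \prod_(i <- s) \int[P]_w (gp i (X i w))%:E.
  apply: IH => i; rewrite /gp.
  - by case: ifP => // _; exact: measurable_funrpos.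
  - by case: eqP => [->|_] //; exact: ig.
  - case: eqP => [_ r _ _|/eqP ik r si is1]; first exact: funrpos_ge0.
    by rewrite g0// inE negb_or is1 andbT.
have [iN EN] : P.-integrable setT (fun w => (\prod_(i <- s) gn i (X i w))%:E) /\
    \int[P]_w (\prod_(i <- s) gn i (X i w))%:E
    = \prod_(i <- s) \int[P]_w (gn i (X i w))%:E.
  apply: IH => i; rewrite /gn.
  - by case: ifP => // _; exact: measurable_funrneg.
  - by case: eqP => [->|_] //; exact: ig.
  - case: eqP => [_ r _ _|/eqP ik r si is1]; first exact: funrneg_ge0.
    by rewrite g0// inE negb_or is1 andbT.
have gE w : (\prod_(i <- s) g i (X i w) =
    \prod_(i <- s) gp i (X i w) - \prod_(i <- s) gn i (X i w))%R.
  rewrite !(bigD1_seq k)//= {1}/gp {1}/gn !eqxx.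
  rewrite [X in _ = (_ * X - _)%R](eq_bigr (fun i => g i (X i w))); last first.
    by move=> i /negbTE ik; rewrite /gp ik.
  rewrite [X in _ = (_ - _ * X)%R](eq_bigr (fun i => g i (X i w))); last first.
    by move=> i /negbTE ik; rewrite /gn ik.
  by rewrite -mulrBl; congr (_ * _)%R; have /(congr1 (@^~ (X k w)))/esym :=
    funrposBneg (g k).
split.
  under [X in _.-integrable _ X]funext do rewrite gE EFinB.
  exact: integrableB.
under eq_integral do rewrite gE EFinB.
rewrite integralB// Ep EN !(bigD1_seq k)//= {1}/gp {1}/gn !eqxx.
set A := \prod_(_ <- _ | _) _.
have fA : A \is a fin_num.
  rewrite /A big_seq_cond; elim/big_ind : _ => // [x y|j /andP[js jk]];
    first exact: fin_numM.
  by rewrite /gp (negbTE jk); apply: integrable_fin_num => //; exact: ig.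
rewrite (_ : \prod_(i <- s | i != k) \int[P]_w (gn i (X i w))%:E = A); last first.
  by apply: eq_bigr => i /negbTE ik; rewrite /gn /gp ik.
rewrite (_ : \prod_(i <- s | i != k) \int[P]_w (g i (X i w))%:E = A); last first.
  by apply: eq_bigr => i /negbTE ik; rewrite /gp ik.
rewrite -muleBl//; last first.
  by apply: fin_num_adde_defr; exact: integrable_fin_num.
congr (_ * _); rewrite -integralB//.
apply: eq_integral => w _; rewrite -EFinB; congr EFin.
by have /(congr1 (@^~ (X k w)))/esym := funrposBneg (g k).
Qed.

End product.
End indep.

(** * Integrals of real-valued functions *)

Section real_integrable.
Context d (T : measurableType d) (R : realType).
Variables (mu : {measure set T -> \bar R}) (D : set T).
Hypothesis mD : measurable D.
Implicit Types f g : T -> R.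
Local Notation rint f := (mu.-integrable D (EFin \o f)).

Lemma integrableD_real f g : rint f -> rint g -> rint (fun x => f x + g x).
Proof. exact: integrableD. Qed.

Lemma integrableB_real f g : rint f -> rint g -> rint (fun x => f x - g x).
Proof. exact: integrableB. Qed.

Lemma integrableZl_real k f : rint f -> rint (fun x => k * f x).
Proof. exact: integrableZl. Qed.

Lemma integrable_sum_real (J : Type) (s : seq J) (F : J -> T -> R) :
  (forall i, rint (F i)) -> rint (fun x => \sum_(i <- s) F i x).
Proof.
move=> iF; have := @integrable_sum _ _ _ mu _ mD _ s xpredT _ (fun i _ => iF i).
by apply: eq_integrable => // x _ /=; rewrite sumEFin.
Qed.

Lemma Rintegral_sum (J : Type) (s : seq J) (F : J -> T -> R) :
  (forall i, rint (F i)) ->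
  \int[mu]_(x in D) (\sum_(i <- s) F i x) = \sum_(i <- s) \int[mu]_(x in D) F i x.
Proof.
move=> iF; elim: s => [|i s IH].
  rewrite big_nil; under eq_Rintegral do rewrite big_nil.
  by rewrite /Rintegral integral0.
rewrite big_cons -IH -RintegralD//; last exact: integrable_sum_real.
by apply: eq_Rintegral => x _; rewrite big_cons.
Qed.

Lemma le_integrable_real f g : measurable_fun D f -> (forall x, D x -> `|f x| <= g x) ->
  rint g -> rint f.
Proof.
move=> mf fg; apply: le_integrable => //; first exact/measurable_EFinP.
by move=> x Dx; rewrite /= lee_fin (le_trans (fg x Dx))// ler_norm.
Qed.

Lemma EFin_Rintegral f : rint f ->
  (\int[mu]_(x in D) f x)%:E = (\int[mu]_(x in D) (f x)%:E)%E.
Proof. by move=> fi; rewrite /Rintegral fineK//; exact: integrable_fin_num. Qed.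

End real_integrable.

Lemma Rintegral_prod_indep d (T : measurableType d) (R : realType)
    (P : probability T R) (I : finType) (X : I -> T -> R) (s : seq I)
    (g : I -> R -> R) :
  (forall i, measurable_fun setT (X i)) -> independent_RVs P X -> uniq s ->
  (forall i, measurable_fun setT (g i)) ->
  (forall i, i \in s -> P.-integrable setT (EFin \o (fun w => g i (X i w)))) ->
  P.-integrable setT (EFin \o (fun w => \prod_(i <- s) g i (X i w))) /\
  \int[P]_w (\prod_(i <- s) g i (X i w)) = \prod_(i <- s) \int[P]_w g i (X i w).
Proof.
move=> mX indX us mg ig; have [ip Ep] := integral_prod_indep mX indX us mg ig.
split=> //; apply: EFin_inj; rewrite EFin_Rintegral// Ep.
rewrite big_seq [in RHS]big_seq.
elim/big_rec2 : _ => // i x y js ->.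
by rewrite EFinM; congr (_ * _)%E; rewrite EFin_Rintegral//; exact: ig.
Qed.

(** * Second moment of an orthogonal sum *)

Section orthogonal_sum.
Context d (T : measurableType d) (R : realType) (P : probability T R).

(** Only the diagonal of the expanded square survives. Orthogonality replaces independence here
    because the products $z_iz_{i+1}$ of neighbouring indices share a variable. *)
Lemma expectation_sqr_sum_orthogonal (J : finType) (Y : J -> T -> R) (a : J -> R) q :
  (forall i j, P.-integrable setT (EFin \o (fun w => Y i w * Y j w))) ->
  (forall i j, i != j -> \int[P]_w (Y i w * Y j w) = 0) ->
  (forall i, \int[P]_w (Y i w * Y i w) <= q) ->
  P.-integrable setT (EFin \o (fun w => (\sum_i a i * Y i w) ^+ 2)) /\
  \int[P]_w ((\sum_i a i * Y i w) ^+ 2) <= q * \sum_i a i ^+ 2.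
Proof.
move=> iY oY qY.
have E w : (\sum_i a i * Y i w) ^+ 2 = \sum_i \sum_j (a i * a j) * (Y i w * Y j w).
  rewrite expr2 big_distrlr/=; apply: eq_bigr => i _; apply: eq_bigr => j _.
  by ring.
have iE i : P.-integrable setT
  (EFin \o (fun w => \sum_j (a i * a j) * (Y i w * Y j w))).
  by apply: integrable_sum_real => // j; exact: integrableZl_real.
split.
  have := integrable_sum_real measurableT (index_enum J) iE.
  by apply: eq_integrable => // w _ /=; rewrite E.
under eq_Rintegral do rewrite E.
rewrite Rintegral_sum// mulr_sumr; apply: ler_sum => i _.
rewrite Rintegral_sum//; last by move=> j; exact: integrableZl_real.
rewrite (bigD1 i)//= big1 ?addr0.
  by rewrite RintegralZl// -expr2 mulrC ler_wpM2r ?sqr_ge0.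
by move=> j ji; rewrite RintegralZl// oY ?mulr0// eq_sym.
Qed.

End orthogonal_sum.

(** * Moments of the noise *)

Section noise.
Context d (T : measurableType d) (R : realType) (P : probability T R).
Variables (m4 : R) (n : nat) (z : nat -> {RV P >-> R}).
Hypothesis nz : noise m4 n z.
Local Notation rint f := (P.-integrable setT (EFin \o f)).

(** The fourth-moment bound dominates all lower powers, since $|r|^e\le 1+r^4$ for $e\le4$. *)
Lemma noise_integrable_expr i e : (1 <= i <= n)%N -> (e <= 4)%N ->
  rint (fun w => z i w ^+ e).
Proof.
move=> /nz.2 [_ _ z4] e4.
have i4 : rint (fun w => z i w ^+ 4).
  apply/integrableP; split.
    by apply/measurable_EFinP; exact: measurable_funX.
  apply: le_lt_trans (ltry m4); apply: le_trans z4; rewrite unlock.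
  by under eq_integral do rewrite /= ger0_norm ?exprn_even_ge0//.
apply: (@le_integrable_real _ _ _ _ _ measurableT _ (fun w => 1 + z i w ^+ 4)).
- exact: measurable_funX.
- move=> w _; rewrite normrX -(@ger0_norm _ (z i w ^+ 4)) ?exprn_even_ge0//.
  rewrite normrX; have [h|h] := leP `|z i w| 1.
    by apply: (le_trans (exprn_ile1 _ (normr_ge0 _) h)); rewrite lerDl exprn_ge0.
  by apply: (le_trans (ler_weXn2l (ltW h) e4)); rewrite lerDr.
- apply: integrableD_real => //; exact: finite_measure_integrable_cst.
Qed.

Lemma noise_mean i : (1 <= i <= n)%N -> \int[P]_w z i w = 0.
Proof. by move=> /nz.2 [+ _ _]; rewrite unlock /Rintegral => ->. Qed.

Lemma noise_var i : (1 <= i <= n)%N -> \int[P]_w (z i w ^+ 2) = 1.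
Proof.
move=> /nz.2 [E0 + _]; rewrite /variance covariance.unlock E0 => V1.
rewrite /Rintegral -[RHS]/(fine 1%:E) -V1 expectation.unlock.
by congr fine; apply: eq_integral => w _ /=; rewrite !fctE /= !subr0 expr2.
Qed.

Lemma noise_fourth i : (1 <= i <= n)%N -> \int[P]_w (z i w ^+ 4) <= m4.
Proof.
move=> ni; have [_ _ +] := nz.2 _ ni; rewrite -lee_fin EFin_Rintegral//.
  by rewrite unlock.
exact: noise_integrable_expr.
Qed.

Lemma noise_prod (s : seq nat) (g : nat -> R -> R) : uniq s ->
  (forall i, i \in s -> (1 <= i <= n)%N) ->
  (forall i, measurable_fun setT (g i)) ->
  (forall i, i \in s -> rint (fun w => g i (z i w))) ->
  rint (fun w => \prod_(i <- s) g i (z i w)) /\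
  \int[P]_w (\prod_(i <- s) g i (z i w)) = \prod_(i <- s) \int[P]_w g i (z i w).
Proof.
move=> us sn mg ig.
(* Noise indices run from 1 to [n], whereas independence is stated over ['I_n]; the list is pulled
   back along the successor. *)
have [s' s's] : exists s' : seq 'I_n, s = [seq (i : 'I_n).+1 | i <- s'].
  elim: s sn {us ig} => [|i s IH] sn; first by exists [::].
  have [|s' ->] := IH; first by move=> j js; apply: sn; rewrite inE js orbT.
  have /andP[i0 iN] := sn i (mem_head _ _).
  have iN' : (i.-1 < n)%N by rewrite prednK.
  by exists (Ordinal iN' :: s') => /=; rewrite prednK.
have us' : uniq s' by move: us; rewrite s's => /map_uniq.
have := @Rintegral_prod_indep _ T R P 'I_n (fun i => z i.+1 : T ->
  R) s' (fun i => g i.+1) _ nz.1 us'.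
have -> : \prod_(i <- s) \int[P]_w g i (z i w)
  = \prod_(i <- s') \int[P]_w g i.+1 (z i.+1 w).
  by rewrite s's big_map.
have -> : (fun w => \prod_(i <- s) g i (z i w))
  = (fun w => \prod_(i <- s') g i.+1 (z i.+1 w)).
  by apply/funext => w; rewrite s's big_map.
apply => //.
by move=> i js'; apply: ig; rewrite s's; exact: map_f.
Qed.

Lemma noise_monomial (s : seq nat) (e : nat -> nat) : uniq s ->
  (forall i, i \in s -> (1 <= i <= n)%N) ->
  (forall i, e i <= 4)%N ->
  rint (fun w => \prod_(i <- s) z i w ^+ e i) /\
  \int[P]_w (\prod_(i <- s) z i w ^+ e i) = \prod_(i <- s) \int[P]_w (z i w ^+ e i).
Proof.
move=> us sn e4; apply: (@noise_prod s (fun i r => r ^+ e i)) => //.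
- by move=> i si; apply: noise_integrable_expr => //; exact: sn.
Qed.

(** A variable occurring to the first power contributes its zero mean as a factor. *)
Lemma noise_monomial_eq0 (s : seq nat) (e : nat -> nat) k : uniq s ->
  (forall i, i \in s -> (1 <= i <= n)%N) ->
  (forall i, e i <= 4)%N -> k \in s -> e k = 1%N ->
  rint (fun w => \prod_(i <- s) z i w ^+ e i) /\
  \int[P]_w (\prod_(i <- s) z i w ^+ e i) = 0.
Proof.
move=> us sn e4 ks ek; have [? ->] := noise_monomial us sn e4; split => //.
rewrite (bigD1_seq k)//= ek; under eq_Rintegral do rewrite expr1.
by rewrite noise_mean ?mul0r//; exact: sn.
Qed.

Lemma noise_orthogonal (g : R -> R) i j : (1 <= i <= n)%N -> (1 <= j <= n)%N ->
  i != j -> measurable_fun setT g ->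
  (forall k, (1 <= k <= n)%N -> rint (fun w => g (z k w))) ->
  \int[P]_w g (z i w) = 0 ->
  rint (fun w => g (z i w) * g (z j w)) /\
  \int[P]_w (g (z i w) * g (z j w)) = 0.
Proof.
move=> ni nj ij mg ig g0.
have [] := @noise_prod [:: i; j] (fun=> g).
- by rewrite /= inE ij.
- by move=> k; rewrite !inE => /orP[] /eqP ->.
- by [].
- by move=> k; rewrite !inE => /orP[] /eqP ->; exact: ig.
rewrite 2!big_cons big_nil g0 mul0r => ip Ep; split.
  by apply: eq_integrable ip => // w _ /=; rewrite !big_cons big_nil mulr1.
by rewrite -Ep; apply: eq_Rintegral => w _; rewrite !big_cons big_nil mulr1.
Qed.

(** For [j = i.+1] the product is $z_iz_{i+1}^2z_{i+2}$; otherwise it has four distinct variables.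
    Either way $z_i$ occurs to the first power. *)
Lemma noise_products_orthogonal i j :
  (1 <= i)%N -> (i < n)%N -> (j < n)%N -> (i < j)%N ->
  rint (fun w => z i w * z i.+1 w * (z j w * z j.+1 w)) /\
  \int[P]_w (z i w * z i.+1 w * (z j w * z j.+1 w)) = 0.
Proof.
move=> i1 iN jN ij.
have [ji|ji] := eqVneq j i.+1.
  have [] := @noise_monomial_eq0 [:: i; i.+1; i.+2]
    (fun k => if k == i.+1 then 2 else 1)%N i.
  - by rewrite /= !inE; lia.
  - by move=> k; rewrite !inE => /or3P[] /eqP ->; lia.
  - by move=> k; case: ifP.
  - by rewrite inE eqxx.
  - by rewrite ifF//; lia.
  have E w : \prod_(k <- [:: i; i.+1; i.+2]) z k w ^+ (if k == i.+1 then 2 else 1)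
      = z i w * z i.+1 w * (z j w * z j.+1 w).
    rewrite !big_cons big_nil eqxx !ifF; try lia.
    by rewrite ji; ring.
  move=> ip Ep; split; first by apply: eq_integrable ip => // w _ /=; rewrite E.
  by rewrite -Ep; apply: eq_Rintegral => w _; rewrite E.
have [] := @noise_monomial_eq0 [:: i; i.+1; j; j.+1] (fun=> 1)%N i.
- by rewrite /= !inE; lia.
- by move=> k; rewrite !inE => /or4P[] /eqP ->; lia.
- by [].
- by rewrite inE eqxx.
- by [].
have E w : \prod_(k <- [:: i; i.+1; j; j.+1]) z k w ^+ 1
    = z i w * z i.+1 w * (z j w * z j.+1 w).
  by rewrite !big_cons big_nil; ring.
move=> ip Ep; split; first by apply: eq_integrable ip => // w _ /=; rewrite E.
by rewrite -Ep; apply: eq_Rintegral => w _; rewrite E.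
Qed.

Lemma noise_product_sqr i : (1 <= i)%N -> (i < n)%N ->
  rint (fun w => z i w * z i.+1 w * (z i w * z i.+1 w)) /\
  \int[P]_w (z i w * z i.+1 w * (z i w * z i.+1 w)) = 1.
Proof.
move=> i1 iN.
have [] := @noise_monomial [:: i; i.+1] (fun=> 2)%N.
- by rewrite /= !inE; lia.
- by move=> k; rewrite !inE => /orP[] /eqP ->; lia.
- by [].
have E w : \prod_(k <- [:: i; i.+1]) z k w ^+ 2
    = z i w * z i.+1 w * (z i w * z i.+1 w).
  by rewrite !big_cons big_nil; ring.
move=> ip Ep; split; first by apply: eq_integrable ip => // w _ /=; rewrite E.
rewrite (_ : 1 = \prod_(i <- [:: i; i.+1]) \int[P]_w (z i w ^+ 2)).
  by rewrite -Ep; apply: eq_Rintegral => w _; rewrite E.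
by rewrite !big_cons big_nil !noise_var ?mulr1//; lia.
Qed.

End noise.

(** * Calculus of one-sided derivatives on [0,1] *)

Section derive01.
Variable R : realType.
Implicit Types (g f V : R -> R) (x y u a M : R).

Lemma derivable01_dist g x : derivable01 g -> x \in `[0, 1] ->
  forall e, 0 < e -> exists2 r, 0 < r & forall y, y \in `[0, 1] -> y != x ->
    `|x - y| < r -> `|derive01 g x - (g y - g x) / (y - x)| < e.
Proof.
move=> dg xI e e0.
have : diff_quot01 g x --> derive01 g x := dg x xI.
rewrite /diff_quot01 => /cvgrPdist_lt/(_ e e0) [r /= r0 H].
by exists r => // y yI yx xyr; exact: H.
Qed.

Lemma derivable01_continuous g : derivable01 g -> {within `[0, 1], continuous g}.
Proof.
move=> dg; apply/subspace_continuousP => x /= xI.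
apply/cvgrPdist_lt => e e0.
have [r r0 H] := derivable01_dist dg xI ltr01.
set L := derive01 g x in H.
have L0 : 0 < `|L| + 1 by rewrite ltr_wpDl.
exists (Num.min r (e / (`|L| + 1))) => /=; first by rewrite lt_min r0 divr_gt0.
move=> y /=; rewrite lt_min => /andP[yr ye] yI.
have [->|yx] := eqVneq y x; first by rewrite subrr normr0.
have yx0 : y - x != 0 by rewrite subr_eq0.
have := H y yI yx yr; rewrite distrC => Hy.
have Hq : `|(g y - g x) / (y - x)| < `|L| + 1.
  by rewrite -[X in `|X|](subrK L) addrC (le_lt_trans (ler_normD _ _))// ltrD2l.
rewrite distrC -(divfK yx0 (g y - g x)) normrM
  (@le_lt_trans _ _ ((`|L| + 1) * `|y - x|))//.
  by rewrite ler_wpM2r// ltW.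
by rewrite mulrC -ltr_pdivlMr// distrC.
Qed.

(** Within distance $\min(x,1-x)$ of an interior point nothing leaves $[0,1]$, so the restricted
    quotient has the same limit as the usual one. *)
Lemma derivable01_is_derive g x : derivable01 g -> 0 < x < 1 ->
  is_derive x 1 g (derive01 g x).
Proof.
move=> dg /andP[x0 x1].
have xI : x \in `[0, 1] by rewrite in_itv/= !ltW.
suff cv : h^-1 *: ((g \o shift x) (h *: 1) - g x) @[h --> 0^'] --> derive01 g x.
  by apply: DeriveDef; [apply/cvg_ex; eexists; exact: cv|exact: cvg_lim cv].
apply/cvgrPdist_lt => e e0.
have [r r0 H] := derivable01_dist dg xI e0.
exists (Num.min r (Num.min x (1 - x))) => /=.
  by rewrite !lt_min r0 x0 subr_gt0.
move=> h /=; rewrite sub0r normrN !lt_min => /and3P[hr hx hx1] h0.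
have := H (h + x); rewrite addrK opprD addrCA subrr addr0 normrN.
rewrite -[h%:A]/(h * 1) mulr1 mulrC; apply => //.
  by move: hx hx1; rewrite in_itv/= !ltr_norml; lra.
by rewrite -subr_eq0 addrK.
Qed.

(** The polynomial is subtracted here, where the mean value point is interior and ordinary
    derivatives are available; Taylor's formula then never needs [derive01] of a polynomial. *)
Lemma MVT01_lt g (p : {poly R}) x y : derivable01 g ->
  x \in `[0, 1] -> y \in `[0, 1] -> x < y -> exists2 c, x < c < y &
    (g y - p.[y]) - (g x - p.[x]) = (derive01 g c - p^`().[c]) * (y - x).
Proof.
move=> dg; rewrite !in_itv/= => /andP[x0 x1] /andP[y0 y1] xy.
have [||c cI E] := @MVT R (g - horner p) (fun u => derive01 g u - p^`().[u]) x y xy.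
- move=> c; rewrite in_itv/= => /andP[xc cy].
  apply: is_deriveB; apply: derivable01_is_derive => //.
  by rewrite (le_lt_trans x0 xc) (lt_le_trans cy y1).
- apply: within_continuousB.
    apply: continuous_subspaceW (derivable01_continuous dg) => u /=.
    by rewrite !in_itv/= => /andP[xu uy]; rewrite (le_trans x0 xu) (le_trans uy y1).
  by apply: continuous_subspaceT; exact: continuous_horner.
- by exists c.
Qed.

Lemma MVT01 g (p : {poly R}) x y : derivable01 g ->
  x \in `[0, 1] -> y \in `[0, 1] -> exists2 c, c \in `[0, 1] /\ `|c - x| <= `|y - x| &
    (g y - p.[y]) - (g x - p.[x]) = (derive01 g c - p^`().[c]) * (y - x).
Proof.
move=> dg xI yI; have [xy|yx|<-] := ltgtP x y.
- have [c cxy E] := MVT01_lt p dg xI yI xy; exists c => //.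
  move: xI yI cxy; rewrite !in_itv/= => /andP[? ?] /andP[? ?] /andP[? ?].
  by split; [lra|rewrite !ger0_norm; lra].
- have [c cxy E] := MVT01_lt p dg yI xI yx; exists c => //.
    move: xI yI cxy; rewrite !in_itv/= => /andP[? ?] /andP[? ?] /andP[? ?].
    by split; [lra|rewrite !ler0_norm; lra].
  by rewrite -[LHS]opprB E -mulrN opprB.
- by exists x; rewrite ?subrr ?mulr0.
Qed.

Lemma poly_primitive (q : {poly R}) m a : (size q <= m)%N ->
  exists p : {poly R}, [/\ (size p <= m.+1)%N, p`_0 = a & p^`() = q].
Proof.
move=> qm; exists (\poly_(i < m.+1) (if i == 0%N then a else q`_i.-1 / i%:R)).
split; [exact: size_poly|by rewrite coef_poly|].
apply/polyP => i; rewrite coef_deriv coef_poly ltnS /=.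
case: ltnP => im; first by rewrite -[LHS]mulr_natr divfK// pnatr_eq0.
by rewrite mul0rn nth_default// (leq_trans qm).
Qed.

(** The approximating polynomial of [derive01 g] is integrated, with constant term [g x]. The mean
    value theorem for the difference, which vanishes at [x], gives the error of the derivative at
    some [c] no farther from [x] than [u], times $|u-x|$; hence one more power at the same constant
    [M]. Higher coefficients need not be identified: vanishing moments will remove them. *)
Lemma taylor01 m g b M x : 0 <= b -> 0 <= M ->
  (forall k, (k < m)%N -> derivable01 (iter k (@derive01 R) g)) ->
  (forall x y, x \in `[0, 1] -> y \in `[0, 1] ->
    `|iter m (@derive01 R) g x - iter m (@derive01 R) g y| <= M * `|x - y| `^ b) ->
  x \in `[0, 1] ->
  exists q : {poly R}, [/\ (size q <= m.+1)%N, q`_0 = g x &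
    forall u, u \in `[0, 1] -> `|g u - q.[u - x]| <= M * `|u - x| `^ (m%:R + b)].
Proof.
move=> b0 M0; elim: m g => [|m IH] g dg lg xI.
  exists (g x)%:P; split; [exact: size_polyC_leq1|by rewrite coefC|].
  by move=> u uI; rewrite hornerC add0r; exact: lg.
have [k km|y y' yI y'I||q1 [sq1 q10 Hq1]] := IH (derive01 g).
- by have := dg k.+1 km; rewrite iterSr.
- by have := lg _ _ yI y'I; rewrite !iterSr.
- exact: xI.
have [q [sq q0 dq]] := poly_primitive (g x) sq1.
exists q; split=> // u uI.
pose p := q \Po ('X - x%:P).
have pE y : p.[y] = q.[y - x] by rewrite horner_comp !hornerE.
have dpE y : p^`().[y] = q1.[y - x].
  by rewrite deriv_comp derivXsubC mulr1 horner_comp !hornerE dq.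
have [c [cI cx] E] := MVT01 p (dg 0%N isT) xI uI.
move: E; rewrite /= !pE subrr horner_coef0 q0 subrr subr0 dpE => ->.
have [->|ux] := eqVneq u x.
  by rewrite subrr mulr0 normr0 mulr_ge0// powR_ge0.
rewrite normrM.
have -> : m.+1%:R + b = (m%:R + b) + 1 by rewrite -addn1 natrD; ring.
rewrite powRD; last by rewrite implybE normr_eq0 subr_eq0 ux orbT.
rewrite powRr1// mulrA ler_wpM2r//.
apply: (le_trans (Hq1 c cI)); rewrite ler_wpM2l//.
by apply: ge0_ler_powR; rewrite ?nnegrE// addr_ge0.
Qed.

Lemma sfloorE a : 0 < a -> a <= (sfloor a)%:R + 1 /\ (sfloor a)%:R < a.
Proof.
move=> a0; have c1 : 1 <= Num.ceil a by rewrite -gtz0_ge1 ltNge ceil_le0 -ltNge.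
have -> : (sfloor a)%:R = (Num.ceil a)%:~R - 1 :> R.
  by rewrite /sfloor natr_absz ger0_norm ?subr_ge0// intrD.
have := ceil_itv a => /andP[]; rewrite intrD => *; lra.
Qed.

Lemma sfloor_le1 a : 0 < a -> a <= 1 -> sfloor a = 0%N.
Proof.
move=> a0 a1; have [_ sa] := sfloorE a0.
by apply/eqP; rewrite -leqn0 -ltnS -(ltr_nat R) (lt_le_trans sa).
Qed.

Lemma sfloor_gt1 a : 1 < a -> (0 < sfloor a)%N.
Proof.
move=> a1; have [sa _] := sfloorE (lt_trans ltr01 a1).
by rewrite -(ltr_nat R) /=; lra.
Qed.

(** For $a\le1$ this is the Hölder condition of the class, and for $a>2$ the class bounds $g'$ by
    $M$. For $1<a\le2$ it bounds $g$ and the increments of $g'$: the mean value theorem on $[0,1]$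
    gives a point where $|g'|=|g(1)-g(0)|\le2M$, and $g'$ varies by at most $M$ from there, whence
    the factor 3. *)
Lemma lipschitz_class_lipschitz a M g : 0 < a -> 0 < M -> lipschitz_class a M g ->
  forall x y, x \in `[0, 1] -> y \in `[0, 1] ->
    `|g x - g y| <= 3 * M * `|x - y| `^ Num.min a 1.
Proof.
move=> a0 M0 [dg bg hg] x y xI yI; have [a1|a1] := leP a 1.
  move: (hg _ _ xI yI); rewrite sfloor_le1//= subr0 => H.
  by apply: (le_trans H); rewrite ler_wpM2r ?powR_ge0//; lra.
have s1 := sfloor_gt1 a1.
have b x' y' : x' \in `[0, 1] -> y' \in `[0, 1] -> `|g x' - g y'| <= 2 * M.
  move=> x'I y'I; rewrite (le_trans (ler_normB _ _))//.
  have := bg 0%N s1 _ x'I; have := bg 0%N s1 _ y'I => /=; lra.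
suff dM c : c \in `[0, 1] -> `|derive01 g c| <= 3 * M.
  have [c [cI _]] := MVT01 0 (dg 0%N s1) yI xI.
  rewrite deriv0 !horner0 !subr0 /= => ->.
  by rewrite normrM powRr1// ler_wpM2r// dM.
move=> cI; have [s2|s2] := ltnP 1 (sfloor a).
  by have := bg 1%N s2 _ cI => /=; lra.
have sE : sfloor a = 1%N by apply/eqP; rewrite eqn_leq s2.
have I0 : (0 : R) \in `[0, 1] by rewrite in_itv/= lexx ler01.
have I1 : (1 : R) \in `[0, 1] by rewrite in_itv/= lexx ler01.
have [c' [c'I _]] := MVT01 0 (dg 0%N s1) I0 I1.
rewrite deriv0 !horner0 !subr0 mulr1 /= => gc'.
have := b _ _ I1 I0; rewrite gc' => bc'.
have : `|derive01 g c - derive01 g c'| <= M.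
  have := hg _ _ cI c'I; rewrite sE /= => H; apply: (le_trans H).
  rewrite -[leRHS]mulr1 ler_wpM2l ?(ltW M0)//.
  have e1 : 1 `^ (a - 1) = 1 :> R by rewrite powR1.
  rewrite -[leRHS]e1; apply: ge0_ler_powR; rewrite ?nnegrE//.
    by rewrite subr_ge0 ltW.
  by move: cI c'I; rewrite !in_itv/= ler_norml; lra.
move=> H; rewrite -[derive01 g c](subrK (derive01 g c')).
by rewrite (le_trans (ler_normD _ _))//; lra.
Qed.

Lemma variance_class_bound b M V : 0 < b -> variance_class b M V ->
  forall x, x \in `[0, 1] -> 0 <= V x <= M.
Proof.
move=> b0 [[_ bV _] V0 VM] x xI; rewrite V0//=; have [b1|b1] := leP b 1.
  exact: VM.
by have := bV 0%N (sfloor_gt1 b1) x xI; rewrite /= ger0_norm// V0.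
Qed.

Lemma lipschitz_class_taylor b M V : 0 < b -> 0 < M -> lipschitz_class b M V ->
  forall x, x \in `[0, 1] ->
  exists q : {poly R}, [/\ (size q <= (sfloor b).+1)%N, q`_0 = V x &
    forall u, u \in `[0, 1] -> `|V u - q.[u - x]| <= M * `|u - x| `^ b].
Proof.
move=> b0 M0 [dV _ hV] x xI; have [_ sb] := sfloorE b0.
have sb0 : 0 <= b - (sfloor b)%:R by rewrite subr_ge0 ltW.
have [q []] := taylor01 sb0 (ltW M0) dV hV xI.
by rewrite addrC subrK; exists q.
Qed.

Lemma lipschitz_class_continuous a M g : 0 < a -> 0 < M -> lipschitz_class a M g ->
  {within `[0, 1], continuous g}.
Proof.
move=> a0 M0 gL; have H := lipschitz_class_lipschitz a0 M0 gL.
have p0 : 0 < Num.min a 1 by rewrite lt_min a0 ltr01.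
apply/subspace_continuousP => x /= xI; apply/cvgrPdist_lt => e e0.
(* At this radius the Hölder bound with constant [3 * M] equals [3 / 4 * e], leaving room for the
   strict inequality. *)
exists ((e / (4 * M)) `^ (Num.min a 1)^-1) => /=.
  by rewrite powR_gt0// divr_gt0// mulr_gt0.
move=> y /= xy yI; rewrite (le_lt_trans (H _ _ xI yI))//.
have : `|x - y| `^ Num.min a 1 <= e / (4 * M).
  have -> : e / (4 * M) = ((e / (4 * M)) `^ (Num.min a 1)^-1) `^ Num.min a 1.
    rewrite -powRrM mulVf ?lt0r_neq0// powRr1//.
    by rewrite divr_ge0 ?mulr_ge0 ?(ltW e0) ?(ltW M0).
  apply: ge0_ler_powR; rewrite ?nnegrE ?powR_ge0 ?(ltW p0)//.
  exact: ltW.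
move=> /(ler_wpM2l (ltW (mulr_gt0 (ltr0Sn R 2) M0))) => /le_lt_trans; apply.
have -> : 3 * M * (e / (4 * M)) = 3 / 4 * e by field; rewrite lt0r_neq0.
lra.
Qed.

End derive01.

(** * Rescaled kernels *)

Section affine_change_of_variables.
Variable R : realType.
Local Notation mu := (@lebesgue_measure R).
Variables (x c : R).
Hypothesis c0 : c != 0.
Let phi (v : R) : R := x + c * v.

Let mphi : measurable_fun setT (phi : R -> R).
Proof. by apply: measurable_funD => //; exact: measurable_funM. Qed.

(** By uniqueness of Lebesgue measure it suffices to compare on half-open intervals. For negative
    [c] the preimage is closed on the other side, which does not change its length. *)
Lemma lebesgue_measure_affine (A : set R) : measurable A ->
  mu A = (`|c|%:E * mu (phi @^-1` A))%E.
Proof.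
pose k : {nonneg R} := NngNum (normr_ge0 c).
pose mu' : {measure set (measurableTypeR R) -> \bar R} :=
  mscale k (pushforward mu (phi : measurableTypeR R -> measurableTypeR R)).
move=> mA; rewrite (@lebesgue_measure_unique R (mu' mphi))// => _ [[a b] _ <-] /=.
rewrite /mu' /mscale/= /pushforward.
have [cp|cn|/esym/eqP] := ltgtP 0 c; last by rewrite (negbTE c0).
  have -> : phi @^-1` `]a, b]%classic = `](a - x) / c, (b - x) / c]%classic.
    apply/seteqP; split => v /=; rewrite !in_itv/= /phi.
      by rewrite ltr_pdivrMr// ler_pdivlMr// => /andP[av vb]; lra.
    by rewrite ltr_pdivrMr// ler_pdivlMr// => /andP[av vb]; lra.
  rewrite !lebesgue_measure_itv/= !lte_fin ltr_pM2r ?invr_gt0// ltrD2r.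
  case: ifP => _; last by rewrite mule0.
  by rewrite -!EFinB -EFinM; congr EFin; rewrite gtr0_norm//; field.
have -> : phi @^-1` `]a, b]%classic = `[(b - x) / c, (a - x) / c[%classic.
  apply/seteqP; split => v /=; rewrite !in_itv/= /phi.
    by rewrite ltr_ndivlMr// ler_ndivrMr// => /andP[av vb]; lra.
  by rewrite ltr_ndivlMr// ler_ndivrMr// => /andP[av vb]; lra.
rewrite !lebesgue_measure_itv/= !lte_fin ltr_nM2r ?invr_lt0// ltrD2r.
case: ifP => _; last by rewrite mule0.
by rewrite -!EFinB -EFinM; congr EFin; rewrite ltr0_norm//; field.
Qed.

Lemma ge0_integral_affine (f : R -> \bar R) : measurable_fun setT f ->
  (forall u, 0 <= f u)%E ->
  (\int[mu]_u f u = `|c|%:E * \int[mu]_v f (x + c * v)%R)%E.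
Proof.
move=> mf f0.
pose k : {nonneg R} := NngNum (normr_ge0 c).
pose mu' : {measure set (measurableTypeR R) -> \bar R} :=
  mscale k (pushforward mu (phi : measurableTypeR R -> measurableTypeR R)).
rewrite (@eq_measure_integral _ _ _ _ (mu' mphi)); last first.
  by move=> A mA _; exact: lebesgue_measure_affine.
by rewrite ge0_integral_mscale//= ge0_integral_pushforward.
Qed.

Lemma integrable_affine (f : R -> R) : measurable_fun setT f ->
  mu.-integrable setT (EFin \o (fun v => f (x + c * v))) ->
  mu.-integrable setT (EFin \o f).
Proof.
move=> mf /integrableP[_ fi]; apply/integrableP; split; first exact/measurable_EFinP.
rewrite (@ge0_integral_affine (fun u => `|(f u)%:E|%E))//.
  by rewrite lte_mul_pinfty.
by apply: measurableT_comp => //; exact/measurable_EFinP.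
Qed.

Lemma Rintegral_affine (f : R -> R) : measurable_fun setT f ->
  mu.-integrable setT (EFin \o (fun v => f (x + c * v))) ->
  \int[mu]_u f u = `|c| * \int[mu]_v f (x + c * v).
Proof.
move=> mf fi; have fi' := integrable_affine mf fi.
have ge0 (g : R -> R) : measurable_fun setT g -> (forall u, 0 <= g u) ->
    mu.-integrable setT (EFin \o (fun v => g (x + c * v))) ->
    \int[mu]_u g u = `|c| * \int[mu]_v g (x + c * v).
  move=> mg g0 gi; rewrite /Rintegral (@ge0_integral_affine (EFin \o g))//=.
    by rewrite fineM//; exact: integrable_fin_num.
  exact/measurable_EFinP.
have pn u : f u = f^\+ u - f^\- u by have /(congr1 (@^~ u)) := funrposBneg f.
under eq_Rintegral do rewrite pn.
under [in RHS]eq_Rintegral do rewrite pn.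
have ip := integrable_funrpos measurableT fi.
have iN := integrable_funrneg measurableT fi.
rewrite !RintegralB//; last 2 first.
- exact: integrable_funrpos.
- exact: integrable_funrneg.
rewrite mulrBr -!ge0//.
- exact: measurable_funrneg.
- exact: measurable_funrpos.
Qed.

End affine_change_of_variables.

(** * Kernels localized around a point *)

Section local_kernel.
Variable R : realType.
Local Notation mu := (@lebesgue_measure R).

Lemma le_integrable_lebesgue (D : set R) (f g : R -> R) : measurable D ->
  measurable_fun D f -> (forall u, D u -> `|f u| <= g u) ->
  mu.-integrable D (EFin \o g) -> mu.-integrable D (EFin \o f).
Proof. by move=> mD mf fg; apply: (@le_integrable_real _ _ _ mu D mD f g). Qed.

Lemma integrable_cst_itv (a b r : R) :
  mu.-integrable `[a, b] (EFin \o (fun=> r)).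
Proof.
apply/integrableP; split; first exact/measurable_EFinP.
rewrite /= (eq_integral (cst `|r|%:E))// integral_cst//= lebesgue_measure_itv/=.
by case: ifP => _; rewrite ?mule0// -EFinB -EFinM ltry.
Qed.

Lemma sqr_integrable_itv (a b kap : R) (k : R -> R) : measurable_fun `[a, b] k ->
  (\int[mu]_(v in `[a, b]) ((k v) ^+ 2)%:E <= kap%:E)%E ->
  mu.-integrable `[a, b] (EFin \o (fun v => k v ^+ 2)).
Proof.
move=> mk k2; apply/integrableP; split.
  by apply/measurable_EFinP; exact: measurable_funX.
apply: le_lt_trans (ltry kap); apply: le_trans k2.
by under eq_integral do rewrite /= ger0_norm ?sqr_ge0//.
Qed.

(** Turns square integrability on a bounded interval into integrability, as the kernels come with an
    $L^2$ bound. *)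
Lemma normr_le1_sqr (r : R) : `|r| <= 1 + r ^+ 2.
Proof.
rewrite -(real_normK (num_real r)); have := sqr_ge0 (`|r| - 1).
have := normr_ge0 r; nra.
Qed.

(** Both integrals are integrals over the line: [H] vanishes off $[-1,t]$, and [Hx] puts the
    rescaled support inside $[0,1]$, so no mass is cut off at the boundary. *)
Lemma integrable_scaled (H : R -> R) (t c x : R) : c != 0 ->
  measurable_fun setT H ->
  (forall v, v \notin `[-1, t] -> H v = 0) ->
  (forall v, v \in `[-1, t] -> x + c * v \in `[0, 1]) ->
  mu.-integrable `[-1, t] (EFin \o H) ->
  mu.-integrable `[0, 1] (EFin \o (fun u => `|c|^-1 * H ((u - x) / c))) /\
  \int[mu]_(u in `[0, 1]) (`|c|^-1 * H ((u - x) / c)) = \int[mu]_(v in `[-1, t]) H v.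
Proof.
move=> c0 mH H0 Hx iH.
pose f u := `|c|^-1 * H ((u - x) / c).
have fE v : f (x + c * v) = `|c|^-1 * H v.
  by rewrite /f; congr (_ * H _); field.
have f0 : f \_ `[0, 1] = f.
  apply/funext => u; rewrite patchE; case: ifPn => // /negP uI.
  rewrite /f H0 ?mulr0//; apply/negP => /Hx; rewrite mulrC divfK// addrC subrK => uI'.
  by apply: uI; rewrite inE.
have HE : H \_ `[-1, t] = H.
  apply/funext => u; rewrite patchE; case: ifPn => // /negP uI.
  by rewrite H0//; apply/negP => uI'; apply: uI; rewrite inE.
have mf : measurable_fun setT f.
  apply: measurable_funM => //; apply: measurableT_comp => //.
  by apply: measurable_funM => //; exact: measurable_funB.
have iHT : mu.-integrable setT (EFin \o H).
  have := (@integrable_mkcond _ _ _ mu `[-1, t]%classic (EFin \o H)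
    (measurable_itv _)).1 iH.
  by rewrite restrict_EFin HE.
have ifT : mu.-integrable setT (EFin \o (fun v => f (x + c * v))).
  rewrite (_ : (fun v => f (x + c * v)) = (fun v => `|c|^-1 * H v)).
    exact: integrableZl_real.
  exact/funext.
split.
  by apply/integrable_mkcond => //; rewrite restrict_EFin f0;
    exact: integrable_affine ifT.
rewrite Rintegral_mkcond f0 (Rintegral_affine c0 mf ifT).
under eq_Rintegral do rewrite fE.
by rewrite RintegralZl// mulrA divff ?mul1r ?normr_eq0// -[in LHS]HE -Rintegral_mkcond.
Qed.

(* The interior kernel and both boundary kernels, rescaled around x, enter the
   argument only through these properties. *)
Definition local_kernel (m : nat) (kap h x : R) (G : R -> R) : Prop :=
  [/\ measurable_fun setT G,
      forall u, h < `|u - x| -> G u = 0,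
      mu.-integrable `[0, 1] (EFin \o (fun u => G u ^+ 2)) /\
        \int[mu]_(u in `[0, 1]) (G u ^+ 2) <= kap / h,
      \int[mu]_(u in `[0, 1]) G u = 1
    & forall i, (1 <= i <= m)%N ->
        \int[mu]_(u in `[0, 1]) (G u * (u - x) ^+ i) = 0].

(* Here c = - h for the interior and left boundary kernels, whose argument is
   (x - u) / h, and c = h for the reflected right boundary kernels. *)
Lemma scaled_kernel_local (m : nat) (kap t c x : R) (k : R -> R) :
  measurable_fun setT k -> c != 0 -> 0 <= t <= 1 ->
  (forall v, v \notin `[-1, t] -> k v = 0) ->
  (forall v, v \in `[-1, t] -> x + c * v \in `[0, 1]) ->
  \int[mu]_(v in `[-1, t]) k v = 1 ->
  (forall i, (1 <= i <= m)%N -> \int[mu]_(v in `[-1, t]) (k v * v ^+ i) = 0) ->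
  (\int[mu]_(v in `[(-1)%R, t]) ((k v) ^+ 2)%:E <= kap%:E)%E ->
  local_kernel m kap `|c| x (fun u => `|c|^-1 * k ((u - x) / c)).
Proof.
move=> mk c0 /andP[t0 t1] k0 kx k1 km k2.
have mkt : measurable_fun (`[-1, t] : set R) k by exact: measurable_funTS.
have ik2 := sqr_integrable_itv mkt k2.
have iki i : mu.-integrable `[-1, t] (EFin \o (fun v => k v * v ^+ i)).
  apply: (@le_integrable_lebesgue _ _ (fun v => 1 + k v ^+ 2)) => //.
  - by apply: measurable_funM => //; exact: measurable_funX.
  - move=> v /= vI; rewrite normrM normrX -[leRHS]mulr1 ler_pM ?normr_le1_sqr//.
    by rewrite exprn_ile1// ler_norml; move: vI; rewrite in_itv/=; lra.
  - by apply: integrableD_real => //; exact: integrable_cst_itv.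
have c0' : `|c| != 0 by rewrite normr_eq0.
split.
- apply: measurable_funM => //; apply: measurableT_comp => //.
  by apply: measurable_funM => //; exact: measurable_funB.
- move=> u ux; rewrite k0 ?mulr0//; apply: contraTN ux => vI.
  rewrite -leNgt -[u - x](divfK c0) normrM ler_piMl//.
  by rewrite ler_norml; move: vI; rewrite in_itv/=; lra.
(* The square of the rescaled kernel is the rescaling of $|c|^{-1}k^2$; this extra factor produces
   [kap / h]. *)
- have [||||iG EG] := @integrable_scaled (fun v => `|c|^-1 * k v ^+ 2) t c x c0.
  + by apply: measurable_funM => //; exact: measurable_funX.
  + by move=> v /k0 ->; rewrite expr0n mulr0.
  + exact: kx.
  + exact: integrableZl_real.
  have E u : (`|c|^-1 * k ((u - x) / c)) ^+ 2
    = `|c|^-1 * (`|c|^-1 * k ((u - x) / c) ^+ 2).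
    by rewrite exprMn expr2 mulrA.
  split; first by apply: eq_integrable iG => // u _ /=; rewrite E.
  under eq_Rintegral do rewrite E.
  rewrite EG RintegralZl// mulrC ler_wpM2r ?invr_ge0//.
  by rewrite -lee_fin EFin_Rintegral.
- have [||||_ ->] := @integrable_scaled k t c x c0 => //.
  by apply: eq_integrable (iki 0%N) => // v _ /=; rewrite mulr1.
- move=> i im.
  have [||||_ EG] := @integrable_scaled (fun v => c ^+ i * (k v * v ^+ i)) t c x c0.
  + apply: measurable_funM => //; apply: measurable_funM => //; exact: measurable_funX.
  + by move=> v /k0 ->; rewrite mul0r mulr0.
  + exact: kx.
  + exact: integrableZl_real.
  transitivity (\int[mu]_(v in `[-1, t]) (c ^+ i * (k v * v ^+ i))).
    rewrite -EG; apply: eq_Rintegral => u _.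
    rewrite -mulrA; congr (_ * _); rewrite mulrCA -exprMn; congr (_ * _ ^+ _).
    by rewrite mulrC divfK.
  by rewrite RintegralZl// km// mulr0.
Qed.

Lemma local_kernel_integrable m kap h x G : local_kernel m kap h x G ->
  mu.-integrable `[0, 1] (EFin \o G).
Proof.
case=> mG _ [iG2 _] _ _; apply:
  (@le_integrable_lebesgue _ _ (fun v => 1 + G v ^+ 2)) => //.
- exact: measurable_funTS.
- by move=> u _; exact: normr_le1_sqr.
- by apply: integrableD_real => //; exact: integrable_cst_itv.
Qed.

(** The bandwidth cancels between the squared norm, at most [kap / h], and the length $2h$ of the
    interval carrying [G]: the former contributes [kap / 2], the latter 1. *)
Lemma local_kernel_L1 m kap h x G : 0 < h -> local_kernel m kap h x G ->
  \int[mu]_(u in `[0, 1]) `|G u| <= (kap + 2) / 2.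
Proof.
move=> h0 lG; have iG := local_kernel_integrable lG.
case: lG => mG G0 [iG2 G2] _ _.
have mJ : measurable (`[x - h, x + h]%classic : set R) by [].
have iJ : mu.-integrable `[0, 1] (EFin \o (\1_(`[x - h, x + h]%classic) : R -> R)).
  apply: (@le_integrable_lebesgue _ _ (fun=> 1)) => //.
  - by move=> u _; rewrite /indic; case: (_ \in _); rewrite ?normr1 ?normr0.
  - exact: integrable_cst_itv.
have IJ : \int[mu]_(u in `[0, 1]) (\1_(`[x - h, x + h]%classic) u) <= 2 * h.
  rewrite -lee_fin EFin_Rintegral// integral_indic//.
  apply: (@le_trans _ _ (mu `[x - h, x + h]%classic)).
    by apply: le_measure; rewrite ?inE//; exact: measurableI.
  rewrite lebesgue_measure_itv/= lte_fin; case: ifP => _;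
    last by rewrite lee_fin mulr_ge0// ltW.
  by rewrite -EFinB lee_fin; lra.
(* AM-GM: 2 |G| <= h G^2 + 1 / h on the support of G *)
apply: (@le_trans _ _ (\int[mu]_(u in `[0, 1])
    (h / 2 * G u ^+ 2 + (2 * h)^-1 * \1_(`[x - h, x + h]%classic) u))).
  apply: le_Rintegral => //.
  - exact: integrable_norm.
  - by apply: integrableD_real => //; exact: integrableZl_real.
  - move=> u _; have [hu|hu] := ltP h `|u - x|.
      by rewrite G0// normr0 expr0n/= mulr0 add0r mulr_ge0// invr_ge0 mulr_ge0// ltW.
    have -> : \1_(`[x - h, x + h]%classic) u = 1 :> R.
      by rewrite indicE mem_set//= in_itv/=; move: hu; rewrite ler_norml; lra.
    rewrite -(real_normK (num_real (G u))).
    rewrite -subr_ge0.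
    have -> : h / 2 * `|G u| ^+ 2 + (2 * h)^-1 * 1 - `|G u|
        = (h * `|G u| - 1) ^+ 2 / (2 * h) by field; rewrite lt0r_neq0.
    by rewrite divr_ge0 ?sqr_ge0// mulr_ge0// ltW.
rewrite RintegralD//; [|exact: integrableZl_real|exact: integrableZl_real].
rewrite !RintegralZl//.
have -> : (kap + 2) / 2 = h / 2 * (kap / h) + (2 * h)^-1 * (2 * h).
  by field; rewrite lt0r_neq0.
by rewrite lerD// ler_wpM2l// ?invr_ge0 ?mulr_ge0 ?divr_ge0 ?(ltW h0).
Qed.

Lemma local_kernel_poly m kap h x G (q : {poly R}) : local_kernel m kap h x G ->
  (size q <= m.+1)%N ->
  mu.-integrable `[0, 1] (EFin \o (fun u => G u * q.[u - x])) /\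
  \int[mu]_(u in `[0, 1]) (G u * q.[u - x]) = q`_0.
Proof.
move=> lG sq; have iG := local_kernel_integrable lG.
case: lG => mG G0 _ G1 Gm.
have E u : G u * q.[u - x] = \sum_(i < m.+1) q`_i * (G u * (u - x) ^+ i).
  rewrite (horner_coef_wide _ sq) mulr_sumr; apply: eq_bigr => i _.
  by rewrite mulrCA.
have iGi i : mu.-integrable `[0, 1] (EFin \o (fun u => G u * (u - x) ^+ i)).
  apply: (@le_integrable_lebesgue _ _ (fun u => (1 + `|x|) ^+ i * `|G u|)) => //.
  - apply: measurable_funTS; apply: measurable_funM => //.
    by apply: measurable_funX; exact: measurable_funB.
  - move=> u /=; rewrite in_itv/= => /andP[u0 u1].
    rewrite normrM normrX mulrC ler_wpM2r// lerXn2r// ?nnegrE ?addr_ge0//.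
    by rewrite (le_trans (ler_normB _ _))// lerD2r ger0_norm.
  - by apply: integrableZl_real => //; exact: integrable_norm.
split.
  have := @integrable_sum_real _ _ R mu `[0, 1]%classic (measurable_itv _) 'I_m.+1
    (index_enum _) (fun i u => q`_i * (G u * (u - x) ^+ i)).
  have iGi' (i : 'I_m.+1) : mu.-integrable `[0, 1]
      (EFin \o (fun u => q`_i * (G u * (u - x) ^+ i))) by exact: integrableZl_real.
  by move=> /(_ iGi'); apply: eq_integrable => // u _ /=; rewrite E.
under eq_Rintegral do rewrite E.
rewrite Rintegral_sum//; last by move=> i; exact: integrableZl_real.
rewrite big_ord_recl big1 ?addr0 /=.
  rewrite RintegralZl//; under eq_Rintegral do rewrite expr0 mulr1.
  by rewrite G1 mulr1.
by move=> i _; rewrite RintegralZl// Gm ?mulr0//; have := ltn_ord i; rewrite /bump; lia.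
Qed.

End local_kernel.

(** * Discretization over the cells *)

Section cells.
Variable R : realType.
Local Notation mu := (@lebesgue_measure R).
Variable n : nat.
Hypothesis n2 : (2 <= n)%N.
Let N : R := n%:R.
Let N0 : 0 < N. Proof. by rewrite ltr0n; lia. Qed.

(** Right end of the [i]-th cell and left end of the next one; the values 0 at index 0 and 1 at
    index [n.-1] encode that the outer cells extend to the ends of $[0,1]$. *)
Definition breakpoint (i : nat) : R :=
  if i == 0%N then 0 else if i == n.-1 then 1 else (design R n i + design R n i.+1) / 2.

Lemma cell_breakpoints i : (1 <= i < n)%N ->
  @cell R n i = `[breakpoint i.-1, breakpoint i]%classic.
Proof.
move=> iN; rewrite /cell /breakpoint.
have -> : (i.-1 == 0 = (i == 1))%N by lia.
have -> : (i.-1 == n.-1 = false)%N by lia.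
have -> : (i == 0 = false)%N by lia.
by rewrite prednK//; lia.
Qed.

(** After multiplication by $n$ a breakpoint is $0$, $i+1/2$ or $n=i+1$. This one enclosure covers
    the irregular outer cells as well, and the estimates on cells below rest on it. *)
Lemma breakpoint_bounds i : (i < n)%N -> i%:R <= N * breakpoint i <= i%:R + 1.
Proof.
move=> iN; rewrite /breakpoint; have [->|i0] := eqVneq i 0%N.
  by rewrite mulr0 lexx add0r ler01.
have [->|iN1] := eqVneq i n.-1.
  have -> : (n.-1)%:R = N - 1 :> R by rewrite /N -{2}(@prednK n) -?natr1 ?addrK//; lia.
  by rewrite mulr1 subrK lexx andbT lerBlDr lerDl ler01.
have -> : N * ((design R n i + design R n i.+1) / 2) = i%:R + 2^-1.
  by rewrite /design -natr1 -/N; field; rewrite lt0r_neq0.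
by apply/andP; split; lra.
Qed.

Lemma breakpoint_le i : (i.+1 < n)%N -> breakpoint i <= breakpoint i.+1.
Proof.
move=> iN; rewrite -(ler_pM2l N0).
have /andP[_ b1] := breakpoint_bounds (ltnW iN).
have /andP[b2 _] := breakpoint_bounds iN.
by rewrite (le_trans b1)// natr1.
Qed.

Lemma breakpoint01 i : (i < n)%N -> 0 <= breakpoint i <= 1.
Proof.
move=> iN; have /andP[b1 b2] := breakpoint_bounds iN.
rewrite -(ler_pM2l N0) mulr0 (le_trans _ b1)//= -(ler_pM2l N0) mulr1.
by rewrite (le_trans b2)// natr1 ler_nat.
Qed.

Lemma breakpoint_last : breakpoint n.-1 = 1.
Proof. by rewrite /breakpoint eqxx ifF//; lia. Qed.

Lemma cell_sub i : (1 <= i < n)%N -> @cell R n i `<=` `[0, 1]%classic.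
Proof.
move=> iN u; rewrite cell_breakpoints//= !in_itv/= => /andP[bu ub].
have /andP[b1 _] : 0 <= breakpoint i.-1 <= 1 by apply: breakpoint01; lia.
have /andP[_ b2] : 0 <= breakpoint i <= 1 by apply: breakpoint01; lia.
by rewrite (le_trans b1) ?(le_trans ub).
Qed.

Lemma cell_length i : (1 <= i < n)%N -> breakpoint i - breakpoint i.-1 <= 2 / N.
Proof.
move=> iN; rewrite ler_pdivlMr// mulrC mulrBr.
have /andP[_ b1] : _ <= _ <= _ := breakpoint_bounds (proj2 (andP iN)).
have /andP[b2 _] : i.-1%:R <= N * breakpoint i.-1 <= i.-1%:R + 1
  by apply: breakpoint_bounds; lia.
have : i%:R = i.-1%:R + 1 :> R by rewrite natr1 prednK//; lia.
by move=> iE; lra.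
Qed.

Lemma cell_design i u : (1 <= i < n)%N -> @cell R n i u ->
  `|design R n i - u| <= 2 / N /\ `|design R n i.+1 - u| <= 2 / N.
Proof.
move=> iN; rewrite cell_breakpoints//= in_itv/= => /andP[bu ub].
have /andP[_ b1] : _ <= _ <= _ := breakpoint_bounds (proj2 (andP iN)).
have /andP[b2 _] : i.-1%:R <= N * breakpoint i.-1 <= i.-1%:R + 1
  by apply: breakpoint_bounds; lia.
have iE : i%:R = i.-1%:R + 1 :> R by rewrite natr1 prednK//; lia.
have ux r : `|r - N * u| <= 2 -> `|r / N - u| <= 2 / N.
  move=> H; have -> : r / N - u = (r - N * u) / N by field; rewrite lt0r_neq0.
  by rewrite normrM (gtr0_norm (x := N^-1)) ?invr_gt0// ler_wpM2r// invr_ge0 ltW.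
have lu : N * breakpoint i.-1 <= N * u by rewrite ler_pM2l.
have uu : N * u <= N * breakpoint i by rewrite ler_pM2l.
by rewrite /design; split; apply: ux; rewrite ler_norml -?natr1; lra.
Qed.

Lemma design01 i : (i <= n)%N -> design R n i \in `[0, 1].
Proof.
by move=> iN; rewrite in_itv/= /design divr_ge0//= ler_pdivrMr// mul1r ler_nat.
Qed.

Lemma Rintegral_itv_split (F : R -> R) (a b c : R) : a <= b -> b <= c ->
  mu.-integrable `[a, c] (EFin \o F) ->
  \int[mu]_(u in `[a, c]) F u = \int[mu]_(u in `[a, b]) F u
    + \int[mu]_(u in `[b, c]) F u.
Proof.
move=> ab bc iF.
have := @Rintegral_itvB R F (BLeft a) (BRight c) b iF; rewrite !bnd_simp => /(_ ab bc).
rewrite Rintegral_itv_obnd_cbnd; last first.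
  apply: integrableS iF => //; apply: subset_itv; rewrite ?bnd_simp//.
by move/eqP; rewrite subr_eq addrC => /eqP.
Qed.

Lemma Rintegral_cells (F : R -> R) : mu.-integrable `[0, 1] (EFin \o F) ->
  \int[mu]_(u in `[0, 1]) F u = \sum_(1 <= i < n) \int[mu]_(u in @cell R n i) F u.
Proof.
move=> iF.
suff H k : (k < n)%N ->
    \int[mu]_(u in `[0, breakpoint k]) F u
      = \sum_(1 <= i < k.+1) \int[mu]_(u in @cell R n i) F u.
  by have := H n.-1; rewrite breakpoint_last prednK ?leqnn; [apply|lia].
elim: k => [_|k IH kN].
  by rewrite big_geq// /breakpoint eqxx set_itv1 Rintegral_set1.
have /andP[b0 b1] := breakpoint01 kN.
have /andP[b0' b1'] := breakpoint01 (ltnW kN).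
rewrite (@Rintegral_itv_split _ 0 (breakpoint k))//.
- by rewrite IH ?(ltnW kN)// [in RHS]big_nat_recr//= cell_breakpoints.
- exact: breakpoint_le.
- by apply: integrableS iF => //; apply: subset_itvl; rewrite bnd_simp.
Qed.

Lemma integrable_cell (F : R -> R) i : (1 <= i < n)%N ->
  mu.-integrable `[0, 1] (EFin \o F) -> mu.-integrable (@cell R n i) (EFin \o F).
Proof.
move=> iN; apply: integrableS => //; last exact: cell_sub.
by rewrite cell_breakpoints.
Qed.

Lemma measurable_cell i : (1 <= i < n)%N -> measurable (@cell R n i).
Proof. by move=> iN; rewrite cell_breakpoints. Qed.

Lemma sum_sqr_cells (G : R -> R) : mu.-integrable `[0, 1] (EFin \o G) ->
  mu.-integrable `[0, 1] (EFin \o (fun u => G u ^+ 2)) ->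
  \sum_(1 <= i < n) (\int[mu]_(u in @cell R n i) G u) ^+ 2
    <= 2 / N * \int[mu]_(u in `[0, 1]) (G u ^+ 2).
Proof.
move=> iG iG2; rewrite Rintegral_cells// mulr_sumr.
rewrite big_nat [leRHS]big_nat; apply: ler_sum => i iN.
have mc := measurable_cell iN.
have iGc := integrable_cell iN iG.
have iG2c := integrable_cell iN iG2.
set w := \int[mu]_(u in @cell R n i) G u.
set S := \int[mu]_(u in @cell R n i) (G u ^+ 2).
set l := 2 / N; have l0 : 0 < l by rewrite divr_gt0.
have ic r : mu.-integrable (@cell R n i) (EFin \o (fun=> r)).
  by rewrite cell_breakpoints//; exact: integrable_cst_itv.
(* Cauchy-Schwarz on the cell, with l in place of its length *)
have : 0 <= \int[mu]_(u in @cell R n i) ((G u - w / l) ^+ 2).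
  by apply: Rintegral_ge0 => u _; exact: sqr_ge0.
have E u : (G u - w / l) ^+ 2 = G u ^+ 2 - (2 * (w / l)) * G u + (w / l) ^+ 2 by ring.
under eq_Rintegral do rewrite E.
rewrite RintegralD//; last first.
  by apply: integrableB_real => //; exact: integrableZl_real.
rewrite RintegralB//; last exact: integrableZl_real.
rewrite RintegralZl// -/w -/S Rintegral_cst//.
have mul : fine (mu (@cell R n i)) <= l.
  rewrite cell_breakpoints// lebesgue_measure_itv/=; case: ifP => _;
    last by rewrite ltW.
  exact: cell_length.
move=> H; have {}H : 0 <= S - 2 * (w / l) * w + (w / l) ^+ 2 * l.
  by apply: (le_trans H); rewrite lerD2l ler_wpM2l// sqr_ge0.
have E2 : S - 2 * (w / l) * w + (w / l) ^+ 2 * l = S - w ^+ 2 / l.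
  by field; rewrite lt0r_neq0.
by move: H; rewrite E2 subr_ge0 ler_pdivrMr// mulrC.
Qed.

(** On a cell, [v i] is a constant that can be moved under the integral of [G] and compared with [V]
    there. Since [G] may change sign, the total cost is measured by its $L^1$ norm. *)
Lemma le_sum_cells (G : R -> R) (v : nat -> R) (V : R -> R) eta : 0 <= eta ->
  mu.-integrable `[0, 1] (EFin \o G) ->
  mu.-integrable `[0, 1] (EFin \o (fun u => G u * V u)) ->
  (forall i u, (1 <= i < n)%N -> @cell R n i u -> `|v i - V u| <= eta) ->
  `|\sum_(1 <= i < n) (\int[mu]_(u in @cell R n i) G u) * v i
    - \int[mu]_(u in `[0, 1]) (G u * V u)|
  <= eta * \int[mu]_(u in `[0, 1]) `|G u|.
Proof.
move=> eta0 iG iGV vV; have inG : mu.-integrable `[0, 1] (EFin \o (fun u => `|G u|)).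
  exact: integrable_norm.
rewrite !Rintegral_cells// -sumrB mulr_sumr (le_trans (ler_norm_sum _ _ _))//.
rewrite big_nat [leRHS]big_nat; apply: ler_sum => i iN.
have mc := measurable_cell iN.
have iGc := integrable_cell iN iG.
have iGVc := integrable_cell iN iGV.
have inGc := integrable_cell iN inG.
have iGv : mu.-integrable (@cell R n i) (EFin \o (fun u => G u * v i)).
  have : mu.-integrable (@cell R n i) (EFin \o (fun u => v i * G u))
    by exact: integrableZl_real.
  by apply: eq_integrable => // u _ /=; rewrite mulrC.
rewrite -RintegralZr// -RintegralB//.
have iD : mu.-integrable (@cell R n i) (EFin \o (fun u => G u * v i - G u * V u)).
  exact: integrableB_real.
rewrite (le_trans (le_normr_Rintegral _ _))// -RintegralZl//.
apply: le_Rintegral => //.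
- exact: integrable_norm.
- exact: integrableZl_real.
- by move=> u cu; rewrite -mulrBr normrM mulrC ler_wpM2r// vV.
Qed.

(** Two comparisons, each paid with the $L^1$ norm of [G]: the sum with $\int GV$, and [V] with its
    Taylor polynomial where $|u-x|\le h$. The moments of [G] then turn the integral of the
    polynomial into exactly [V x]. *)
Lemma local_kernel_bias b M h x (G V : R -> R) (v : nat -> R) kap eta :
  0 < b -> 0 < M -> 0 < h -> x \in `[0, 1] -> 0 <= eta ->
  lipschitz_class b M V -> local_kernel (sfloor b) kap h x G ->
  (forall i u, (1 <= i < n)%N -> @cell R n i u -> `|v i - V u| <= eta) ->
  `|\sum_(1 <= i < n) (\int[mu]_(u in @cell R n i) G u) * v i - V x|
  <= (eta + M * h `^ b) * ((kap + 2) / 2).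
Proof.
move=> b0 M0 h0 xI eta0 VL lG vV.
have iG := local_kernel_integrable lG.
have inG : mu.-integrable `[0, 1] (EFin \o (fun u => `|G u|)).
  exact: integrable_norm.
have [q [sq q0 Vq]] := lipschitz_class_taylor b0 M0 VL xI.
have [iGq IGq] := local_kernel_poly lG sq.
have Gle u : `[0, 1]%classic u -> `|G u * V u - G u * q.[u - x]| <= M * h `^ b * `|G u|.
  move=> uI; rewrite -mulrBr normrM mulrC; have [hu|hu] := ltP h `|u - x|.
    by case: lG => _ G0 _ _ _; rewrite G0// normr0 !mulr0.
  rewrite ler_wpM2r// (le_trans (Vq u uI))// ler_wpM2l ?(ltW M0)//.
  by apply: ge0_ler_powR; rewrite ?nnegrE ?(ltW b0) ?(ltW h0).
have mV : measurable_fun (`[0, 1]%classic : set R) V.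
  by apply: subspace_continuous_measurable_fun => //;
    exact: lipschitz_class_continuous VL.
have mG : measurable_fun (`[0, 1]%classic : set R) G.
  by case: lG => mG _ _ _ _; exact: measurable_funTS.
have mq : measurable_fun (`[0, 1]%classic : set R) (fun u => G u * q.[u - x]).
  by have := measurable_int _ iGq; move/measurable_EFinP.
have iD : mu.-integrable `[0, 1] (EFin \o (fun u => G u * V u - G u * q.[u - x])).
  apply: (@le_integrable_lebesgue _ _ _ (fun u => M * h `^ b * `|G u|)) => //.
  - by apply: measurable_funB => //; exact: measurable_funM.
  - exact: integrableZl_real.
have iGV : mu.-integrable `[0, 1] (EFin \o (fun u => G u * V u)).
  have : mu.-integrable `[0,
    1] (EFin \o (fun u => (G u * V u - G u * q.[u - x]) + G u * q.[u - x])).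
    exact: integrableD_real.
  by apply: eq_integrable => // u _ /=; rewrite subrK.
have L1 := local_kernel_L1 h0 lG.
have Mh : 0 <= M * h `^ b by rewrite mulr_ge0 ?powR_ge0 ?(ltW M0).
rewrite -(subrK (\int[mu]_(u in `[0, 1]) (G u * V u)) (\sum_(1 <= i < n) _)) -addrA.
rewrite (le_trans (ler_normD _ _))// mulrDl lerD//.
  by rewrite (le_trans (le_sum_cells eta0 iG iGV vV))// ler_wpM2l.
rewrite -q0 -IGq -RintegralB// (le_trans (le_normr_Rintegral _ _))//.
apply: le_trans (ler_wpM2l Mh L1); rewrite -RintegralZl//.
apply: le_Rintegral => //; first exact: integrable_norm.
exact: integrableZl_real.
Qed.

(** The cell comparison with [V] equal to zero; it will bound the contribution of the squared
    increments of the mean function. *)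
Lemma local_kernel_sum_abs m kap h x (G : R -> R) (v : nat -> R) D :
  0 < h -> 0 <= D -> local_kernel m kap h x G ->
  (forall i, (1 <= i < n)%N -> `|v i| <= D) ->
  `|\sum_(1 <= i < n) (\int[mu]_(u in @cell R n i) G u) * v i| <= D * ((kap + 2) / 2).
Proof.
move=> h0 D0 lG vD; have iG := local_kernel_integrable lG.
have iG0 : mu.-integrable `[0, 1] (EFin \o (fun u => G u * (fun=> 0) u)).
  rewrite (_ : (fun u => _) = (fun=> 0)); first exact: integrable_cst_itv.
  by apply/funext => u; rewrite mulr0.
have := @le_sum_cells G v (fun=> 0) D D0 iG iG0.
rewrite [X in _ - X](_ : _ = 0); last first.
  by under eq_Rintegral do rewrite mulr0; rewrite Rintegral_cst// mul0r.
rewrite subr0 => H; apply: (le_trans (H _)).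
  by move=> i u iN _; rewrite subr0; exact: vD.
by rewrite ler_wpM2l//; exact: local_kernel_L1 h0 lG.
Qed.

Lemma local_kernel_sum_sqr m kap h x (G : R -> R) :
  0 < h -> local_kernel m kap h x G ->
  \sum_(1 <= i < n) (\int[mu]_(u in @cell R n i) G u) ^+ 2 <= 2 * kap / (N * h).
Proof.
move=> h0 lG; have iG := local_kernel_integrable lG.
case: lG => mG _ [iG2 G2] _ _; apply: (le_trans (sum_sqr_cells iG iG2)).
have -> : 2 * kap / (N * h) = 2 / N * (kap / h) by field; rewrite !lt0r_neq0.
by rewrite ler_wpM2l// divr_ge0// ltW.
Qed.

End cells.

(** * Measurability of the weights *)

Section fubini_measurability.
Context d1 d2 (T1 : measurableType d1) (T2 : measurableType d2) (R : realType).
Variable m2 : {sigma_finite_measure set T2 -> \bar R}.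

(** After extension by zero, the integrals of the positive and negative parts are measurable by
    Tonelli; taking their difference and then [fine] preserves this, even where both are
    infinite. *)
Lemma measurable_fun_Rintegral (D1 : set T1) (D2 : set T2) (F : T1 * T2 -> R) :
  measurable D1 -> measurable D2 -> measurable_fun (D1 `*` D2) F ->
  measurable_fun D1 (fun x => \int[m2]_(u in D2) F (x, u)).
Proof.
move=> mD1 mD2 mF.
pose F' := (EFin \o F) \_ (D1 `*` D2).
have mF' : measurable_fun setT F'.
  apply/(measurable_restrictT _ _).1; first exact: measurableX.
  exact/measurable_EFinP.
have E x : D1 x -> (\int[m2]_(u in D2) (F (x, u))%:E = \int[m2]_u F' (x, u))%E.
  move=> D1x; rewrite integral_mkcond; apply: eq_integral => u _.
  rewrite /F' !patchE; case: ifPn => uD.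
    by rewrite mem_set//=; split => //=; exact: set_mem.
  by rewrite memNset//= => -[_ /= /mem_set]; rewrite (negbTE uD).
have mI : measurable_fun setT (fun x => \int[m2]_u F' (x, u))%E.
  rewrite (_ : (fun x => _) = (fun x => fubini_F m2 F'^\+ x - fubini_F m2 F'^\- x))%E.
    by apply: emeasurable_funB; apply: measurable_fun_fubini_tonelli_F => //;
      [exact: measurable_funepos|exact: measurable_funeneg].
  apply/funext => x; rewrite /fubini_F [LHS]integralE.
  under eq_integral do rewrite funepos_comp.
  by under [X in (_ - X)%E]eq_integral do rewrite funeneg_comp.
rewrite /Rintegral; apply:
  (@eq_measurable_fun _ _ T1 R D1 (fun x => fine (\int[m2]_u F' (x, u))%E)).
  by move=> x /set_mem D1x; rewrite E.
apply: measurable_funTS; apply: measurableT_comp => //.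
Qed.

End fubini_measurability.

(** * The kernel in force at a given point *)

Section kernel_at.
Variable R : realType.
Local Notation mu := (@lebesgue_measure R).
Variables (K : R -> R) (Kt : R -> R -> R) (h : R).
Hypothesis h012 : 0 < h < 1 / 2.

(** A single function of $(x,u)$ whose cell integrals are the weights, so that the cell lemmas and
    joint measurability treat the three cases together. *)
Definition kernel_at (x u : R) : R :=
  if h < x < 1 - h then h^-1 * K ((x - u) / h)
  else if x <= h then h^-1 * Kt (x / h) ((x - u) / h)
  else h^-1 * Kt ((1 - x) / h) (- ((x - u) / h)).

Lemma weightE n i x :
  weight K Kt h n i x = \int[mu]_(u in @cell R n i) kernel_at x u.
Proof. by rewrite /weight /kernel_at; case: ifP => // _; case: ifP. Qed.

Lemma measurable_boundary_kernel b khat t :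
  is_boundary_kernel b khat Kt -> t \in `[0, 1] -> measurable_fun setT (Kt t).
Proof.
move=> [mKt _] tI.
rewrite (_ : Kt t = (fun p : R * R => Kt p.1 p.2) \o (fun v => (t, v)))//.
apply: (@measurable_comp _ _ _ _ (R * R)%type R
  ((`[0, 1]%classic : set R) `*` [set: R])) => //.
- exact: measurableX.
- by move=> _ [v _ <-]; split.
- exact: measurable_fun_pair.
Qed.

(** The cases differ in why the rescaled support stays in $[0,1]$. In the interior, $x$ is farther
    than $h$ from both ends. At the left, $v\le x/h$ keeps $x-hv\ge0$, while $x-hv\le2h<1$; at the
    right, $v\le(1-x)/h$ keeps $x+hv\le1$, while $x+hv\ge1-2h>0$. *)
Lemma kernel_at_local b kK khat kap x : is_kernel b kK K ->
  is_boundary_kernel b khat Kt -> kK <= kap -> khat <= kap -> x \in `[0, 1] ->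
  local_kernel (sfloor b) kap h x (kernel_at x).
Proof.
move: h012 => /andP[h0 h2] [mK K0 K1 Km K2] bK kap1 kap2 xI.
move: (xI); rewrite in_itv/= => /andP[x0 x1].
have h0' : h != 0 by rewrite lt0r_neq0.
have nh : `|- h| = h by rewrite normrN gtr0_norm.
have hv v a : h * v <= a <-> v <= a / h by rewrite ler_pdivlMr// mulrC.
have hle v : -1 <= v -> - h <= h * v.
  by move=> v1; rewrite -[- h]mulr1 mulNr -mulrN ler_pM2l.
have hge v : v <= 1 -> h * v <= h by move=> v1; rewrite ler_piMr// ltW.
have [/andP[hx xh]|Hx] := boolP (h < x < 1 - h).
  have -> : kernel_at x = (fun u => h^-1 * K ((u - x) / - h)).
    apply/funext => u; rewrite /kernel_at hx xh/=; congr (_ * K _).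
    by field.
  have := @scaled_kernel_local R (sfloor b) kap 1 (- h) x K; rewrite nh; apply => //.
  - by rewrite oppr_eq0.
  - by rewrite ler01 lexx.
  - move=> v; rewrite !in_itv/= => /andP[/hle v1 /hge v2]; rewrite mulNr; lra.
  - by apply: (le_trans K2); rewrite lee_fin.
have [xh|xh] := leP x h.
  have tI : x / h \in `[0, 1].
    by rewrite in_itv/= divr_ge0 ?(ltW h0)//= ler_pdivrMr// mul1r.
  have [_ /(_ _ tI) [Kt0 Kt1 Ktm Kt2]] := bK.
  have -> : kernel_at x = (fun u => h^-1 * Kt (x / h) ((u - x) / - h)).
    apply/funext => u; rewrite /kernel_at (negbTE Hx) xh/=; congr (_ * Kt _ _).
    by field.
  have := @scaled_kernel_local R (sfloor b) kap (x / h) (- h) x (Kt (x / h)).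
  rewrite nh; apply => //.
  - exact: measurable_boundary_kernel bK tI.
  - by rewrite oppr_eq0.
  - move=> v; rewrite !in_itv/= => /andP[/hle v1 /hv v2]; rewrite mulNr; lra.
  - by apply: (le_trans Kt2); rewrite lee_fin.
have xh' : 1 - h <= x by move: Hx; rewrite xh/= -leNgt.
have tI : (1 - x) / h \in `[0, 1].
  by rewrite in_itv/= divr_ge0 ?subr_ge0 ?(ltW h0)//= ler_pdivrMr// mul1r; lra.
have [_ /(_ _ tI) [Kt0 Kt1 Ktm Kt2]] := bK.
have -> : kernel_at x = (fun u => h^-1 * Kt ((1 - x) / h) ((u - x) / h)).
  apply/funext => u; rewrite /kernel_at (negbTE Hx) leNgt xh/=; congr (_ * Kt _ _).
  by field.
have := @scaled_kernel_local R (sfloor b) kap ((1 - x) / h) h x (Kt ((1 - x) / h)).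
rewrite gtr0_norm//; apply => //.
- exact: measurable_boundary_kernel bK tI.
- move=> v; rewrite !in_itv/= => /andP[/hle v1 /hv v2]; lra.
- by apply: (le_trans Kt2); rewrite lee_fin.
Qed.

(** [Kt] is jointly measurable over $t\in[0,1]$, so each boundary branch is a composition whose
    first component must land there; the conditions selecting the branch guarantee it. *)
Lemma measurable_kernel_at b kK khat : is_kernel b kK K ->
  is_boundary_kernel b khat Kt ->
  measurable_fun ((`[0, 1]%classic : set R) `*` [set: R]) (fun p : R * R =>
    kernel_at p.1 p.2).
Proof.
move: h012 => /andP[h0 h2] [mK _ _ _ _] [mKt _].
have mI : measurable ((`[0, 1]%classic : set R) `*` [set: R]) by exact: measurableX.
have mfst D : measurable_fun D (fst : R * R -> R) by exact: measurable_funTS.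
have msnd D : measurable_fun D (snd : R * R -> R) by exact: measurable_funTS.
have mv D : measurable_fun D (fun p : R * R => (p.1 - p.2) / h).
  by apply: measurable_funM => //; exact: measurable_funB.
have mcond D : measurable_fun D (fun p : R * R => h < p.1 < 1 - h).
  by apply: measurable_and; exact: measurable_fun_ltr.
have mcond2 D : measurable_fun D (fun p : R * R => p.1 <= h).
  exact: measurable_fun_ler.
apply: measurable_fun_if => //.
  apply: measurable_funM => //; exact: measurableT_comp.
have mD1 : measurable ((`[0, 1]%classic : set R) `*` [set: R] `&`
    (fun t : R * R => h < t.1 < 1 - h) @^-1` [set false]) by exact: mcond.
apply: measurable_fun_if => //; apply: measurable_funM => //.
  rewrite (_ : (fun t : R * R => Kt _ _) = (fun p : R * R => Kt p.1 p.2)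
    \o (fun p : R * R => (p.1 / h, (p.1 - p.2) / h)))//.
  apply: (@measurable_comp _ _ _ _ (R * R)%type R
    ((`[0, 1]%classic : set R) `*` [set: R])) => //.
    move=> _ [[x u] [[[/= + _] _] /= xh] <-]; rewrite in_itv/= => /andP[x0 x1].
    split => //=.
    by rewrite in_itv/= divr_ge0 ?(ltW h0)//= ler_pdivrMr// mul1r.
  by apply: measurable_funTS; apply: measurable_fun_pair => //; exact: measurable_funM.
rewrite (_ : (fun t : R * R => Kt _ _) = (fun p : R * R => Kt p.1 p.2)
  \o (fun p : R * R => ((1 - p.1) / h, - ((p.1 - p.2) / h))))//.
apply: (@measurable_comp _ _ _ _ (R * R)%type R
  ((`[0, 1]%classic : set R) `*` [set: R])) => //.
  move=> _ [[x u] [[[/= + _] /= H] /= /negbT xh] <-].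
  rewrite in_itv/= => /andP[x0 x1]; rewrite -ltNge in xh.
  split => //=; have {H} : 1 - h <= x by move/negbT: H; rewrite xh/= -leNgt.
  by rewrite in_itv/= divr_ge0 ?subr_ge0 ?(ltW h0)//= ler_pdivrMr// mul1r; lra.
apply: measurable_funTS; apply: measurable_fun_pair => //; last exact: measurableT_comp.
by apply: measurable_funM => //; exact: measurable_funB.
Qed.

Lemma measurable_weight b kK khat n i : (2 <= n)%N -> (1 <= i < n)%N ->
  is_kernel b kK K -> is_boundary_kernel b khat Kt ->
  measurable_fun (`[0, 1]%classic : set R) (weight K Kt h n i).
Proof.
move=> n2 iN kK' bK'; rewrite (_ : weight K Kt h n i = fun x =>
  \int[mu]_(u in @cell R n i) kernel_at x u).
  have mF := measurable_kernel_at kK' bK'.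
  apply: (@measurable_fun_Rintegral _ _ R (measurableTypeR R) R mu `[0, 1]%classic
    (@cell R n i) (fun p : R * R => kernel_at p.1 p.2)) => //.
    by apply: measurable_cell.
  apply: measurable_funS mF; first exact: measurableX.
  by move=> [x u] [].
by apply/funext => x; exact: weightE.
Qed.

End kernel_at.

(** * Risk bounds *)

Lemma sqr_sum5_le (R : realDomainType) (a b c d e : R) :
  (a + b + c + d + e) ^+ 2 <= 5 * (a ^+ 2 + b ^+ 2 + c ^+ 2 + d ^+ 2 + e ^+ 2).
Proof.
rewrite -subr_ge0.
have -> : 5 * (a ^+ 2 + b ^+ 2 + c ^+ 2 + d ^+ 2 + e ^+ 2) - (a + b + c + d + e) ^+ 2
  = (a - b) ^+ 2 + (a - c) ^+ 2 + (a - d) ^+ 2 + (a - e) ^+ 2 + (b - c) ^+ 2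
    + (b - d) ^+ 2 + (b - e) ^+ 2 + (c - d) ^+ 2 + (c - e) ^+ 2 + (d - e) ^+ 2 by ring.
by rewrite !addr_ge0 ?sqr_ge0.
Qed.

Lemma big_nat1_ord (R : nmodType) n (F : nat -> R) :
  \sum_(1 <= i < n) F i = \sum_(i < n.-1) F i.+1.
Proof. by rewrite big_add1 big_mkord. Qed.

Lemma Rintegral_cst_probability d (T : measurableType d) (R : realType)
  (P : probability T R) (r : R) : \int[P]_t r = r.
Proof. by have := expectation_cst P r; rewrite expectation.unlock /Rintegral => ->. Qed.

(** * Second moment of the centred part *)

Section stochastic_part.
Context d (T : measurableType d) (R : realType) (P : probability T R).
Variables (m4 : R) (n : nat) (z : nat -> {RV P >-> R}).
Hypothesis nz : noise m4 n z.
Local Notation rint f := (P.-integrable setT (EFin \o f)).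
Variables (f V : R -> R) (w : nat -> R) (Df MV : R).
Local Notation del i := (f (design R n i) - f (design R n i.+1)).
Local Notation var i := (V (design R n i)).
Local Notation sd i := (Num.sqrt (V (design R n i))).
Hypothesis hDf : forall i, (1 <= i < n)%N -> `|del i| <= Df.
Hypothesis hV : forall i, (1 <= i <= n)%N -> 0 <= var i <= MV.

Local Notation W2 := (\sum_(i < n.-1) w i.+1 ^+ 2).

Let bounded_orthogonal_sum (Y : 'I_n.-1 -> T -> R) (a : 'I_n.-1 -> R) q B : 0 <= q ->
  (forall i j, rint (fun t => Y i t * Y j t)) ->
  (forall i j, i != j -> \int[P]_t (Y i t * Y j t) = 0) ->
  (forall i, \int[P]_t (Y i t * Y i t) <= q) ->
  (forall i, a i ^+ 2 <= B) ->
  rint (fun t => (\sum_(i < n.-1) (w i.+1 * a i) * Y i t) ^+ 2) /\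
  \int[P]_t ((\sum_(i < n.-1) (w i.+1 * a i) * Y i t) ^+ 2) <= q * B * W2.
Proof.
move=> q0 iY oY qY aB.
have [ir Er] := expectation_sqr_sum_orthogonal (fun i : 'I_n.-1 =>
  w i.+1 * a i) iY oY qY.
split=> //; apply: (le_trans Er); rewrite -mulrA ler_wpM2l// mulr_sumr.
by apply: ler_sum => i _; rewrite exprMn mulrC ler_wpM2r ?sqr_ge0.
Qed.

Let rng (i : 'I_n.-1) : (1 <= i.+1 < n)%N.
Proof. by have := ltn_ord i; lia. Qed.

(** Serves the four families in a single variable: [g] is the identity or $r^2-1$, and [s] selects
    the left or right observation of a pair. Injectivity of [s] makes distinct summands involve
    distinct variables. *)
Let sum_of_noise (g : R -> R) (s : nat -> nat) (a : 'I_n.-1 -> R) q B :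
  (forall i : 'I_n.-1, 1 <= s i <= n)%N -> injective s ->
  0 <= q -> measurable_fun setT g ->
  (forall k, (1 <= k <= n)%N -> rint (fun t => g (z k t))) ->
  (forall k, (1 <= k <= n)%N -> rint (fun t => g (z k t) * g (z k t))) ->
  (forall k, (1 <= k <= n)%N -> \int[P]_t g (z k t) = 0) ->
  (forall k, (1 <= k <= n)%N -> \int[P]_t (g (z k t) * g (z k t)) <= q) ->
  (forall i, a i ^+ 2 <= B) ->
  rint (fun t => (\sum_(i < n.-1) (w i.+1 * a i) * g (z (s i) t)) ^+ 2) /\
  \int[P]_t ((\sum_(i < n.-1) (w i.+1 * a i) * g (z (s i) t)) ^+ 2) <= q * B * W2.
Proof.
move=> sn sinj q0 mg ig ig2 g0 gq aB; apply: bounded_orthogonal_sum => //.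
- move=> i j; have [->|ij] := eqVneq i j; first exact: ig2.
  have [] := @noise_orthogonal _ _ _ _ _ _ _ nz g (s i) (s j) (sn i) (sn j) _ mg
    ig (g0 _ (sn i)) => //.
  by apply: contra_neq ij => /sinj /val_inj.
- move=> i j ij.
  have [] := @noise_orthogonal _ _ _ _ _ _ _ nz g (s i) (s j) (sn i) (sn j) _ mg
    ig (g0 _ (sn i)) => //.
  by apply: contra_neq ij => /sinj /val_inj.
- by move=> i; exact: gq.
Qed.

Let S t := \sum_(i < n.-1) w i.+1 *
  ((obs f V z n i.+1 t - obs f V z n i.+2 t) ^+ 2
    - (del i.+1 ^+ 2 + var i.+1 + var i.+2)).

Let MV0 : (1 < n)%N -> 0 <= MV.
Proof.
move=> n1; have /andP[v0 v1] : 0 <= var 1 <= MV by apply: hV; lia.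
exact: le_trans v1.
Qed.

(** [F] is 5 times the sum of the squares of the five family sums. The coefficients
    $\pm2\delta_iV^{1/2}$ give $4D_f^2M_V$ for each of two families, the coefficients $V$ give
    $|m_4|M_V^2$ for each of two, and $-2(V(x_i)V(x_{i+1}))^{1/2}$ gives $4M_V^2$. *)
Lemma stochastic_part_bound : (1 < n)%N -> exists2 F : T -> R,
  rint F & (forall t, S t ^+ 2 <= F t) /\
  \int[P]_t F t <= 5 * (8 * Df ^+ 2 * MV + 2 * `|m4| * MV ^+ 2 + 4 * MV ^+ 2) * W2.
Proof.
move=> n1; have M0 := MV0 n1.
have var1 (i : 'I_n.-1) : 0 <= var i.+1 <= MV by apply: hV; have := rng i; lia.
have var2 (i : 'I_n.-1) : 0 <= var i.+2 <= MV by apply: hV; have := rng i; lia.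
have sd1 (i : 'I_n.-1) : sd i.+1 ^+ 2 = var i.+1.
  by rewrite sqr_sqrtr//; case/andP: (var1 i).
have sd2 (i : 'I_n.-1) : sd i.+2 ^+ 2 = var i.+2.
  by rewrite sqr_sqrtr//; case/andP: (var2 i).
have del2 (i : 'I_n.-1) : del i.+1 ^+ 2 <= Df ^+ 2.
  by rewrite -(real_normK (num_real (del i.+1))) lerXn2r ?nnegrE// ?hDf//
    (le_trans _ (hDf (rng i))).
have s1 (i : 'I_n.-1) : (1 <= i.+1 <= n)%N by have := rng i; lia.
have s2 (i : 'I_n.-1) : (1 <= i.+2 <= n)%N by have := rng i; lia.
have inj1 : injective (fun i : nat => i.+1) by move=> i j [].
have inj2 : injective (fun i : nat => i.+2) by move=> i j [].
have iz k : (1 <= k <= n)%N -> rint (fun t => z k t).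
  by move=> kn; have := noise_integrable_expr nz (e := 1) kn isT.
have izz k : (1 <= k <= n)%N -> rint (fun t => z k t * z k t).
  by move=> kn; have := noise_integrable_expr nz (e := 2) kn isT.
have i1 : rint (fun=> 1) by exact: finite_measure_integrable_cst.
have m1 k : (1 <= k <= n)%N -> \int[P]_t (z k t * z k t) <= 1.
  by move=> kn; rewrite -[leRHS](noise_var nz kn).
pose g2 (r : R) := r ^+ 2 - 1.
have mg2 : measurable_fun setT g2.
  by apply: measurable_funB => //; exact: exprn_measurable.
have ig2 k : (1 <= k <= n)%N -> rint (fun t => g2 (z k t)).
  by move=> kn; apply: integrableB_real => //; apply: (noise_integrable_expr nz kn).
have g20 k : (1 <= k <= n)%N -> \int[P]_t g2 (z k t) = 0.
  move=> kn; rewrite RintegralB//; last by apply: (noise_integrable_expr nz kn).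
  by rewrite (noise_var nz kn) Rintegral_cst_probability subrr.
have E4 k t : g2 (z k t) * g2 (z k t) = z k t ^+ 4 - 2 * z k t ^+ 2 + 1.
  by rewrite /g2; ring.
have i4 k : (1 <= k <= n)%N -> rint (fun t => z k t ^+ 4 - 2 * z k t ^+ 2).
  move=> kn; apply: integrableB_real => //;
    first by apply: (noise_integrable_expr nz kn).
  by apply: integrableZl_real => //; apply: (noise_integrable_expr nz kn).
have ig22 k : (1 <= k <= n)%N -> rint (fun t => g2 (z k t) * g2 (z k t)).
  move=> kn; have : rint (fun t => (z k t ^+ 4 - 2 * z k t ^+ 2) + 1).
    by apply: integrableD_real => //; exact: i4.
  by apply: eq_integrable => // t _ /=; rewrite E4.
(* $E(z^2-1)^2=Ez^4-1\le m_4$; the absolute value makes the bound visibly nonnegative. *)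
have g2q k : (1 <= k <= n)%N -> \int[P]_t (g2 (z k t) * g2 (z k t)) <= `|m4|.
  move=> kn; under eq_Rintegral do rewrite E4.
  rewrite RintegralD//; last exact: i4.
  rewrite RintegralB//; last 2 first.
  - by apply: (noise_integrable_expr nz kn).
  - by apply: integrableZl_real => //; apply: (noise_integrable_expr nz kn).
  rewrite RintegralZl//; last by apply: (noise_integrable_expr nz kn).
  rewrite (noise_var nz kn) Rintegral_cst_probability.
  have := noise_fourth nz kn; have := ler_norm m4; lra.
have [|ia Ea] := @sum_of_noise id (fun i : nat => i.+1) (fun i : 'I_n.-1 =>
  2 * del i.+1 * sd i.+1)
  1 (4 * Df ^+ 2 * MV) s1 inj1 ler01 (@measurable_id _ _ _) iz izz (noise_mean nz) m1.
  move=> i; rewrite !exprMn sd1; have /andP[v0 v1] := var1 i.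
  by have := ler_pM (sqr_ge0 _) v0 (del2 i) v1; lra.
have [|ib Eb] := @sum_of_noise id (fun i : nat => i.+2) (fun i : 'I_n.-1 =>
  - (2 * del i.+1 * sd i.+2))
  1 (4 * Df ^+ 2 * MV) s2 inj2 ler01 (@measurable_id _ _ _) iz izz (noise_mean nz) m1.
  move=> i; rewrite sqrrN !exprMn sd2; have /andP[v0 v1] := var2 i.
  by have := ler_pM (sqr_ge0 _) v0 (del2 i) v1; lra.
have [|ic Ec] := @sum_of_noise g2 (fun i : nat => i.+1) (fun i : 'I_n.-1 => var i.+1)
  `|m4| (MV ^+ 2) s1 inj1 (normr_ge0 _) mg2 ig2 ig22 g20 g2q.
  by move=> i; have /andP[v0 v1] := var1 i; rewrite lerXn2r ?nnegrE.
have [|iD Ed] := @sum_of_noise g2 (fun i : nat => i.+2) (fun i : 'I_n.-1 => var i.+2)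
  `|m4| (MV ^+ 2) s2 inj2 (normr_ge0 _) mg2 ig2 ig22 g20 g2q.
  by move=> i; have /andP[v0 v1] := var2 i; rewrite lerXn2r ?nnegrE.
have po (i j : 'I_n.-1) : (i < j)%N ->
    rint (fun t => z i.+1 t * z i.+2 t * (z j.+1 t * z j.+2 t)) /\
    \int[P]_t (z i.+1 t * z i.+2 t * (z j.+1 t * z j.+2 t)) = 0.
  move=> ij; apply: (noise_products_orthogonal nz) => //.
    by have := rng i; lia.
  by have := rng j; lia.
have ps (i : 'I_n.-1) : rint (fun t => z i.+1 t * z i.+2 t * (z i.+1 t * z i.+2 t)) /\
    \int[P]_t (z i.+1 t * z i.+2 t * (z i.+1 t * z i.+2 t)) = 1.
  by apply: (noise_product_sqr nz) => //; have := rng i; lia.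
have [||||ie Ee] := @bounded_orthogonal_sum (fun (i : 'I_n.-1) t => z i.+1 t * z i.+2 t)
  (fun i : 'I_n.-1 => - (2 * sd i.+1 * sd i.+2)) 1 (4 * MV ^+ 2) ler01.
- move=> i j; have [ij|ij|ij] := ltngtP i j.
  + by have [] := po _ _ ij.
  + have [+ _] := po _ _ ij.
    by apply: eq_integrable => // t _ /=; rewrite mulrC.
  + by rewrite (val_inj ij); have [] := ps j.
- move=> i j /eqP nij; have [ij|ij|ij] := ltngtP i j.
  + by have [] := po _ _ ij.
  + have [_ <-] := po _ _ ij.
    by apply: eq_Rintegral => t _; rewrite mulrC.
  + by case: nij; exact: val_inj.
- by move=> i; have [_ ->] := ps i.
- move=> i; rewrite sqrrN !exprMn sd1 sd2.
  have /andP[v0 v1] := var1 i; have /andP[v0' v1'] := var2 i.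
  by have := ler_pM v0 v0' v1 v1'; lra.
exists (fun t => 5 * ((\sum_(i < n.-1) (w i.+1 * (2 * del i.+1 * sd i.+1)) * z
  i.+1 t) ^+ 2
  + (\sum_(i < n.-1) (w i.+1 * - (2 * del i.+1 * sd i.+2)) * z i.+2 t) ^+ 2
  + (\sum_(i < n.-1) (w i.+1 * var i.+1) * g2 (z i.+1 t)) ^+ 2
  + (\sum_(i < n.-1) (w i.+1 * var i.+2) * g2 (z i.+2 t)) ^+ 2
  + (\sum_(i < n.-1) (w i.+1 * - (2 * sd i.+1 * sd i.+2)) *
    (z i.+1 t * z i.+2 t)) ^+ 2)).
  by apply: integrableZl_real => //; do !apply: integrableD_real => //.
split.
  move=> t; apply: le_trans (sqr_sum5_le _ _ _ _ _).
  rewrite /S -!big_split/= le_eqVlt; apply/orP; left; apply/eqP; congr (_ ^+ 2).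
  (* Once [V] is written as the square of its root, the five-term decomposition is a polynomial
     identity. *)
  apply: eq_bigr => i _; have := sd1 i; have := sd2 i; rewrite /obs /g2.
  by move: (sd i.+1) (sd i.+2) => a b <- <-; ring.
have iab := integrableD_real measurableT ia ib.
have iabc := integrableD_real measurableT iab ic.
have iabcd := integrableD_real measurableT iabc iD.
rewrite RintegralZl//; last exact: (integrableD_real measurableT iabcd ie).
rewrite RintegralD// RintegralD// RintegralD// RintegralD//.
set X := W2 in Ea Eb Ec Ed Ee *.
by move: Ea Eb Ec Ed Ee => /= Ea Eb Ec Ed Ee; lra.
Qed.

End stochastic_part.

(** * Pointwise and integrated risk *)

Section risk.
Context d (T : measurableType d) (R : realType) (P : probability T R).
Local Notation mu := (@lebesgue_measure R).
Variables (m4 : R) (n : nat) (z : nat -> {RV P >-> R}).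
Hypothesis nz : noise m4 n z.
Hypothesis n1 : (1 < n)%N.
Variables (K : R -> R) (Kt : R -> R -> R) (h : R) (f V : R -> R).

Lemma measurable_obs i : measurable_fun setT (obs f V z n i).
Proof.
apply: measurable_funD => //; exact: measurable_funM.
Qed.

Lemma measurable_Vhat x : measurable_fun setT (Vhat K Kt h n (obs f V z n) x).
Proof.
apply: measurable_funM => //; apply: measurable_sum => i.
apply: measurable_funM => //; apply: measurable_funX.
by apply: measurable_funB; exact: measurable_obs.
Qed.

(** With $b$ the bias and $s$ the centred sum, $(b+s/2)^2\le2b^2+s^2/2$ needs no cross term and
    allows $s^2$ to be replaced by its integrable majorant; the factor 5/2 is half of the 5 found
    there. *)
Lemma pointwise_risk_le (Df MV x : R) :
  (forall i, (1 <= i < n)%N -> `|f (design R n i) - f (design R n i.+1)| <= Df) ->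
  (forall i, (1 <= i <= n)%N -> 0 <= V (design R n i) <= MV) ->
  (pointwise_risk z K Kt h n f V x <=
    (2 * (2^-1 * \sum_(1 <= i < n) weight K Kt h n i x *
       ((f (design R n i) - f (design R n i.+1)) ^+ 2
        + V (design R n i) + V (design R n i.+1)) - V x) ^+ 2
    + 5 / 2 * (8 * Df ^+ 2 * MV + 2 * `|m4| * MV ^+ 2 + 4 * MV ^+ 2)
      * \sum_(1 <= i < n) weight K Kt h n i x ^+ 2)%:E)%E.
Proof.
move=> hDf hV.
have [F iF [SF IF]] := stochastic_part_bound nz (weight K Kt h n ^~ x) hDf hV n1.
set b := 2^-1 * _ - V x; set Q := 5 / 2 * _.
have Fle t : (Vhat K Kt h n (obs f V z n) x t - V x) ^+ 2 <= 2 * b ^+ 2 + 2^-1 * F t.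
  have := SF t; set s := \sum_(_ < _) _ => sF.
  have -> : Vhat K Kt h n (obs f V z n) x t - V x = b + 2^-1 * s.
    rewrite /s /Vhat /b !big_nat1_ord addrAC -mulrDr; congr (_ * _ - _).
    by rewrite -big_split/=; apply: eq_bigr => i _; ring.
  have := sqr_ge0 (b - 2^-1 * s); nra.
have i2 : P.-integrable setT (EFin \o (fun t => 2 * b ^+ 2 + 2^-1 * F t)).
  by apply: integrableD_real => //;
    [exact: finite_measure_integrable_cst|exact: integrableZl_real].
rewrite /pointwise_risk unlock.
apply: (@le_trans _ _ (\int[P]_t (2 * b ^+ 2 + 2^-1 * F t)%:E)%E).
  apply: ge0_le_integral => //.
  - by move=> t _; rewrite lee_fin sqr_ge0.
  - apply/measurable_EFinP; apply: measurable_funX.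
    by apply: measurable_funB => //; exact: measurable_Vhat.
  - exact: measurable_int i2.
  - by move=> t _; rewrite lee_fin.
rewrite -EFin_Rintegral// lee_fin RintegralD//; last 2 first.
- exact: finite_measure_integrable_cst.
- exact: integrableZl_real.
rewrite Rintegral_cst_probability RintegralZl// big_nat1_ord.
by rewrite lerD2l /Q; move: IF; set W := \sum_(_ < _) _; lra.
Qed.

(** Joint measurability reduces to that of the weights and [V] in $x$ and of the observations in the
    sample point. The constant is unchanged because $[0,1]$ has length one. *)
Lemma integrated_risk_le b kK khat C : 0 <= C -> 0 < h < 1 / 2 ->
  is_kernel b kK K -> is_boundary_kernel b khat Kt ->
  measurable_fun (`[0, 1]%classic : set R) V ->
  (forall x, x \in `[0, 1] -> (pointwise_risk z K Kt h n f V x <= C%:E)%E) ->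
  (integrated_risk z K Kt h n f V <= C%:E)%E.
Proof.
move=> C0 h012 kK' bK' mV prC.
pose I01 : set R := `[0, 1]%classic.
pose F (p : T * R) := (Vhat K Kt h n (obs f V z n) p.2 p.1 - V p.2) ^+ 2.
pose F' := (EFin \o F) \_ ([set: T] `*` I01).
have mI : measurable I01 by exact: measurable_itv.
have mD : measurable ([set: T] `*` I01) by exact: measurableX.
have m2 (g : R -> R) : measurable_fun I01 g ->
    measurable_fun ([set: T] `*` I01) (fun p : T * R => g p.2).
  move=> mg; apply: (@measurable_comp _ _ _ _ R R I01 g _ snd) => //.
    by move=> _ [[t x] [_ xI] <-].
  exact: measurable_funTS.
have m1 (g : T -> R) : measurable_fun setT g ->
    measurable_fun ([set: T] `*` I01) (fun p : T * R => g p.1).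
  by move=> mg; apply: measurable_funTS; exact: measurableT_comp.
have mF : measurable_fun ([set: T] `*` I01) F.
  apply: measurable_funX; apply: measurable_funB; last exact: m2.
  rewrite /Vhat; under eq_fun do rewrite big_nat1_ord.
  apply: measurable_funM => //; apply: measurable_sum => i.
  apply: measurable_funM.
    apply: m2; apply: measurable_weight kK' bK' => //.
    by have := ltn_ord i; lia.
  apply: (m1 (fun t => (obs f V z n i.+1 t - obs f V z n i.+2 t) ^+ 2)).
  by apply: measurable_funX; apply: measurable_funB; exact: measurable_obs.
have mF' : @measurable_fun _ _ (T * measurableTypeR R)%type (\bar R) setT F'.
  have mEF : @measurable_fun _ _ (T * R)%type (\bar R) ([set: T] `*` I01) (EFin \o F).
    exact/measurable_EFinP.
  exact: (measurable_restrictT _ mD).1 mEF.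
have F'0 p : (0 <= F' p)%E.
  by rewrite /F' patchE; case: ifP => // _; rewrite lee_fin sqr_ge0.
have -> : integrated_risk z K Kt h n f V = (\int[P]_t \int[mu]_x F' (t, x))%E.
  apply: eq_integral => t _; rewrite integral_mkcond; apply: eq_integral => x _.
  rewrite /F' !patchE; case: ifPn => xI.
    by rewrite mem_set//=; split => //=; exact: set_mem.
  by rewrite memNset//= => -[_ /= /mem_set]; rewrite (negbTE xI).
rewrite (@fubini_tonelli _ _ T (measurableTypeR R) R P mu F')//.
apply: (@le_trans _ _ (\int[mu]_x (C%:E * (\1_I01 x)%:E))%E).
  apply: ge0_le_integral => //.
  - by move=> x _; apply: integral_ge0.
  - exact: (measurable_fun_fubini_tonelli_G F' mF' F'0).
  - by apply/measurable_EFinP; apply: measurable_funM => //; exact: measurable_indic.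
  move=> x _; have [xI|xI] := boolP (x \in I01); last first.
    rewrite indicE (negbTE xI) mule0 integral0_eq// => t _.
    by rewrite /F' patchE memNset//= => -[_ /= /mem_set]; rewrite (negbTE xI).
  rewrite indicE xI mule1; apply: le_trans (prC x (set_mem xI)).
  rewrite /pointwise_risk unlock le_eqVlt; apply/orP; left; apply/eqP.
  apply: eq_integral => t _.
  by rewrite /F' patchE mem_set//=; split => //=; exact: set_mem.
rewrite ge0_integralZl//; last exact/measurable_EFinP/measurable_indic.
rewrite integral_indic// setIT /I01/= lebesgue_measure_itv/= lte_fin ltr01.
by rewrite -EFinB subr0 mule1.
Qed.

End risk.

(** * Comparison of powers of $n$ with the rate *)

Section rates.
Variables (R : realType) (a b : R) (n : nat).
Hypotheses (a0 : 0 < a) (b0 : 0 < b) (n0 : (0 < n)%N).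
Local Notation t := (n%:R : R).
Local Notation r := (2 * b / (1 + 2 * b)).

Let t1 : 1 <= t. Proof. by rewrite ler1n. Qed.
Let t0 : 0 < t. Proof. exact: lt_le_trans t1. Qed.
Let b1 : 0 < 1 + 2 * b. Proof. by rewrite addr_gt0// mulr_gt0. Qed.
Let r0 : 0 < r. Proof. by rewrite divr_gt0// mulr_gt0. Qed.
Let r1 : r < 1. Proof. by rewrite ltr_pdivrMr// mul1r; lra. Qed.

Lemma rate_ge0 : 0 <= rate a b n.
Proof. by rewrite le_max powR_ge0. Qed.

Lemma powR_le_rate e : r <= e -> t `^ (- e) <= rate a b n.
Proof. by move=> re; rewrite le_max; apply/orP; right; rewrite ler_powR// lerN2. Qed.

Lemma powR_expr (e : R) k : (t `^ (- e)) ^+ k = t `^ (- (k%:R * e)).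
Proof. by rewrite -powR_mulrn ?powR_ge0// -powRrM mulNr mulrC. Qed.

Lemma mean_rate : (t `^ (- Num.min a 1)) ^+ 4 <= rate a b n.
Proof.
rewrite powR_expr; have [a1|a1] := leP a 1; first by rewrite le_max lexx.
by apply: powR_le_rate; rewrite mulr1 (le_trans (ltW r1))// ler1n.
Qed.

Lemma powR_inv_nat e : (t^-1) `^ e = t `^ (- e).
Proof. by rewrite -powR_inv1 ?(ltW t0)// -powRrM mulN1r. Qed.

(** For $b\le1$ the exponent $2b$ is at least $2b/(1+2b)$; the 4 bounds the square of
    $2^{\min(b,1)}$. *)
Lemma discretization_rate : ((2 / t) `^ Num.min b 1) ^+ 2 <= 4 * rate a b n.
Proof.
have m0 : 0 < Num.min b 1 by rewrite lt_min b0 ltr01.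
rewrite powRM ?invr_ge0 ?(ltW t0)// powR_inv_nat exprMn powR_expr.
apply: ler_pM; rewrite ?sqr_ge0 ?powR_ge0//.
  have -> : 4 = 2 ^+ 2 :> R by ring.
  rewrite lerXn2r ?nnegrE ?powR_ge0//.
  rewrite -[leRHS]powRr1//; apply: ler_powR; first by rewrite ler1n.
  by rewrite ge_min lexx orbT.
apply: powR_le_rate; have [b1'|_] := leP b 1;
  last by rewrite mulr1 (le_trans (ltW r1))// ler1n.
by rewrite ler_pdivrMr// ler_peMr ?mulr_ge0 ?(ltW b0)// lerDl mulr_ge0 ?(ltW b0).
Qed.

(** The upper side of the bandwidth condition: $h^{2b}$ then has exactly the exponent
    $-2b/(1+2b)$. *)
Lemma bandwidth_rate c2 h : 0 < h -> h * t `^ (1 / (1 + 2 * b)) <= c2 ->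
  (h `^ b) ^+ 2 <= (c2 `^ b) ^+ 2 * rate a b n.
Proof.
move=> h0 hc.
have tg : 0 < t `^ (1 / (1 + 2 * b)) by rewrite powR_gt0.
have c20 : 0 <= c2 by apply: le_trans hc; rewrite mulr_ge0 ?ltW.
have hle : h <= c2 * t `^ (- (1 / (1 + 2 * b))) by rewrite powRN ler_pdivlMr.
have : h `^ b <= c2 `^ b * t `^ (- (1 / (1 + 2 * b) * b)).
  rewrite -mulNr powRrM -powRM ?powR_ge0//.
  by apply: ge0_ler_powR; rewrite ?nnegrE ?mulr_ge0 ?powR_ge0 ?(ltW b0) ?(ltW h0).
move=> H; apply: (@le_trans _ _ ((c2 `^ b * t `^ (- (1 / (1 + 2 * b) * b))) ^+ 2)).
  by rewrite lerXn2r ?nnegrE ?mulr_ge0 ?powR_ge0.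
rewrite exprMn powR_expr ler_wpM2l ?sqr_ge0//; apply: powR_le_rate.
by rewrite le_eqVlt; apply/orP; left; apply/eqP; field; rewrite lt0r_neq0.
Qed.

(** The lower side of the bandwidth condition: $1/(1+2b)-1=-2b/(1+2b)$, the balance that dictates
    the order of $h$. *)
Lemma effective_sample_rate c1 h : 0 < c1 -> 0 < h ->
  c1 <= h * t `^ (1 / (1 + 2 * b)) -> (t * h)^-1 <= c1^-1 * rate a b n.
Proof.
move=> c10 h0 hc.
have tg : 0 < t `^ (1 / (1 + 2 * b)) by rewrite powR_gt0.
apply: (@le_trans _ _ (c1^-1 * t `^ (- r))); last first.
  by rewrite ler_wpM2l ?invr_ge0 ?(ltW c10)//; exact: powR_le_rate.
have -> : - r = 1 / (1 + 2 * b) - 1 by field; rewrite lt0r_neq0.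
rewrite powRD; last by rewrite lt0r_neq0 ?implybT.
rewrite powR_inv1 ?(ltW t0)// invfM mulrA (mulrC t^-1) ler_wpM2r ?invr_ge0 ?(ltW t0)//.
by rewrite -div1r ler_pdivrMr// -mulrA (mulrC _ h) ler_pdivlMl// mulr1.
Qed.

End rates.

(** * Bias and squared weights under the smoothness assumptions *)

Section deterministic_part.
Variable R : realType.
Variables (alpha beta Mf MV kK khat c1 c2 : R).
Hypotheses (alpha0 : 0 < alpha) (beta0 : 0 < beta) (Mf0 : 0 < Mf) (MV0 : 0 < MV).
Hypothesis c10 : 0 < c1.
Variables (K : R -> R) (Kt : R -> R -> R) (h : R) (n : nat).
Hypotheses (n1 : (1 < n)%N) (h012 : 0 < h < 1 / 2).
Hypotheses (hK : is_kernel beta kK K) (hKt : is_boundary_kernel beta khat Kt).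
Hypothesis hh : c1 <= h * n%:R `^ (1 / (1 + 2 * beta)) <= c2.
Variables (f V : R -> R).
Hypotheses (hf : lipschitz_class alpha Mf f) (hV : variance_class beta MV V).
Local Notation t := (n%:R : R).
Local Notation rho := (rate alpha beta n).
(** Dominates the squared norms of the interior and boundary kernels at once; the 1 and the absolute
    values keep it positive for any real [kK] and [khat]. *)
Local Notation kap := (1 + `|kK| + `|khat|).
Local Notation L := ((kap + 2) / 2).
Local Notation Df := (3 * Mf * t `^ (- Num.min alpha 1)).
Local Notation del i := (f (design R n i) - f (design R n i.+1)).

Let n0 : (0 < n)%N. Proof. exact: ltnW. Qed.
Let t0 : 0 < t. Proof. by rewrite ltr0n. Qed.
Let h0 : 0 < h. Proof. by case/andP: h012. Qed.

Lemma mean_increment i : (1 <= i < n)%N -> `|del i| <= Df.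
Proof.
move=> /andP[_ iN].
have := lipschitz_class_lipschitz alpha0 Mf0 hf (design01 R n1 (ltnW iN))
  (design01 R n1 iN).
rewrite -powR_inv_nat//; suff -> : `|design R n i - design R n i.+1| = t^-1 by [].
have -> : design R n i - design R n i.+1 = - t^-1.
  by rewrite /design -natr1; field; rewrite lt0r_neq0.
by rewrite normrN gtr0_norm// invr_gt0.
Qed.

Lemma weight_local_kernel x : x \in `[0, 1] ->
  local_kernel (sfloor beta) kap h x (kernel_at K Kt h x).
Proof.
apply: (kernel_at_local h012 hK hKt).
- by have := ler_norm kK; have := normr_ge0 khat; lra.
- by have := ler_norm khat; have := normr_ge0 kK; lra.
Qed.

(** The bias is at most [L] times $D_f^2/2+\eta+M_Vh^\beta$: half the squared increments, the
    discretization of the average of $V(x_i)$ and $V(x_{i+1})$, and the Taylor remainder. Squaring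
    the three terms costs the 3; then $81/4=3^4/4$ comes from $D_f^4/4$ and $36=9\cdot4$ from
    $\eta^2$. *)
Lemma bias_bound x : x \in `[0, 1] ->
  (2^-1 * \sum_(1 <= i < n) weight K Kt h n i x *
     (del i ^+ 2 + V (design R n i) + V (design R n i.+1)) - V x) ^+ 2
  <= 3 * L ^+ 2 * (81 / 4 * Mf ^+ 4 + 36 * MV ^+ 2 + MV ^+ 2 * (c2 `^ beta) ^+ 2) * rho.
Proof.
move=> xI; have lG := weight_local_kernel xI.
have [VL V0 _] := hV.
set G := kernel_at K Kt h x in lG.
have L0 : 0 <= L by have := normr_ge0 kK; have := normr_ge0 khat; lra.
pose eta := 3 * MV * (2 / t) `^ Num.min beta 1.
have eta0 : 0 <= eta by rewrite mulr_ge0 ?powR_ge0// mulr_ge0// ltW.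
have m0 : 0 <= Num.min beta 1 by rewrite le_min (ltW beta0) ler01.
have Vd y u : y \in `[0, 1] -> u \in `[0, 1] -> `|y - u| <= 2 / t ->
  `|V y - V u| <= eta.
  move=> yI uI yu; apply: (le_trans (lipschitz_class_lipschitz beta0 MV0 VL yI uI)).
  rewrite ler_wpM2l ?mulr_ge0 ?(ltW MV0)//.
  by apply: ge0_ler_powR; rewrite ?nnegrE ?divr_ge0 ?(ltW t0).
have Ha := @local_kernel_sum_abs R n n1 _ _ _ _ _ (fun i =>
  del i ^+ 2) (Df ^+ 2) h0 (sqr_ge0 _) lG _.
have {}Ha : `|\sum_(1 <= i < n) weight K Kt h n i x * del i ^+ 2| <= Df ^+ 2 * L.
  under eq_bigr do rewrite weightE.
  apply: Ha => i iN; rewrite ger0_norm ?sqr_ge0//.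
  rewrite -(real_normK (num_real (del i))) lerXn2r ?nnegrE ?mean_increment//.
  by rewrite !mulr_ge0 ?powR_ge0 ?(ltW Mf0).
have Hb : `|\sum_(1 <= i < n) weight K Kt h n i x *
  ((V (design R n i) + V (design R n i.+1)) / 2) - V x|
    <= (eta + MV * h `^ beta) * L.
  under eq_bigr do rewrite weightE.
  apply: (@local_kernel_bias R n n1 beta MV h x G V
    (fun i => (V (design R n i) + V (design R n i.+1)) / 2) kap eta) => // i u iN cu.
  have [xi xi1] := cell_design n1 iN cu; have uI := cell_sub n1 iN cu.
  have H1 := Vd _ u (design01 R n1 (ltnW (proj2 (andP iN)))) uI xi.
  have H2 := Vd _ u (design01 R n1 (proj2 (andP iN))) uI xi1.
  by move: H1 H2; rewrite !ler_norml; lra.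
set b := 2^-1 * _ - V x.
have bE : b = 2^-1 * (\sum_(1 <= i < n) weight K Kt h n i x * del i ^+ 2)
    + (\sum_(1 <= i < n) weight K Kt h n i x *
      ((V (design R n i) + V (design R n i.+1)) / 2) - V x).
  rewrite /b addrA; congr (_ - _); rewrite !mulr_sumr -big_split/=.
  by apply: eq_bigr => i _; field.
pose B := 2^-1 * Df ^+ 2 + eta + MV * h `^ beta.
have B0 : 0 <= B.
  by rewrite !addr_ge0// mulr_ge0 ?sqr_ge0 ?powR_ge0 ?(ltW MV0)// invr_ge0.
have bB : `|b| <= L * B.
  by rewrite bE (le_trans (ler_normD _ _))// normrM ger0_norm ?invr_ge0// /B; lra.
have b2 : b ^+ 2 <= L ^+ 2 * B ^+ 2.
  rewrite -exprMn -(real_normK (num_real b)) lerXn2r ?nnegrE//.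
  by rewrite mulr_ge0.
have B2 : B ^+ 2 <= 3 * (4^-1 * (Df ^+ 2) ^+ 2 + eta ^+ 2 + (MV * h `^ beta) ^+ 2).
  suff H (p q s : R) : (2^-1 * p + q + s) ^+ 2 <= 3 * (4^-1 * p ^+ 2 + q ^+ 2 + s ^+ 2).
    exact: H.
  have := sqr_ge0 (2^-1 * p - q); have := sqr_ge0 (2^-1 * p - s).
  have := sqr_ge0 (q - s); lra.
have D4 : (Df ^+ 2) ^+ 2 <= 81 * Mf ^+ 4 * rho.
  have -> : (Df ^+ 2) ^+ 2 = 81 * Mf ^+ 4 * (t `^ (- Num.min alpha 1)) ^+ 4 by ring.
  rewrite ler_wpM2l ?mulr_ge0 ?exprn_ge0 ?(ltW Mf0)//.
  exact: mean_rate.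
have E2 : eta ^+ 2 <= 36 * MV ^+ 2 * rho.
  have := discretization_rate alpha beta0 n0; rewrite /eta exprMn => H.
  by have := ler_wpM2l (sqr_ge0 (3 * MV)) H; lra.
have H2 : (MV * h `^ beta) ^+ 2 <= MV ^+ 2 * (c2 `^ beta) ^+ 2 * rho.
  have /andP[_ hc2] := hh.
  rewrite exprMn -mulrA ler_wpM2l ?sqr_ge0//.
  exact: bandwidth_rate.
apply: (le_trans b2); rewrite [3 * _]mulrC -[leRHS]mulrA -[leRHS]mulrA ler_wpM2l
  ?sqr_ge0//.
by apply: (le_trans B2); lra.
Qed.

Lemma weight_sqr_bound x : x \in `[0, 1] ->
  \sum_(1 <= i < n) weight K Kt h n i x ^+ 2 <= 2 * kap / c1 * rho.
Proof.
move=> xI; have lG := weight_local_kernel xI.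
under eq_bigr do rewrite weightE.
apply: (le_trans (local_kernel_sum_sqr n1 h0 lG)).
have /andP[hc1 _] := hh.
have k0 : 0 <= 2 * kap by rewrite mulr_ge0// !addr_ge0.
by rewrite -[leRHS]mulrA ler_wpM2l//; exact: effective_sample_rate.
Qed.

End deterministic_part.

(** * Uniform risk bounds, with one constant for both *)

Theorem theorem1 (R : realType) (alpha beta Mf MV : R)
    (halpha : 0 < alpha) (hbeta : 0 < beta) (hMf : 0 < Mf) (hMV : 0 < MV)
    (kK khat m4 c1 c2 : R) (hc1 : 0 < c1) (hc2 : 0 < c2) :
  exists2 C0 : R, 0 < C0 &
  forall (K : R -> R) (Kt : R -> R -> R) (h : nat -> R),
    is_kernel beta kK K ->
    is_boundary_kernel beta khat Kt ->
    (forall n, (0 < n)%N -> 0 < h n < 1 / 2) ->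
    (forall n, (0 < n)%N ->
       c1 <= h n * n%:R `^ (1 / (1 + 2 * beta)) <= c2) ->
  \forall n \near \oo,
  forall (d : measure_display) (T : measurableType d) (P : probability T R)
    (z : nat -> {RV P >-> R}),
    noise m4 n z ->
    (ereal_sup [set ereal_sup [set pointwise_risk z K Kt (h n) n fV.1 fV.2 x
                              | x in (`[0%R, 1%R]%classic : set R)]
               | fV in lipschitz_class alpha Mf `*` variance_class beta MV]
      <= (C0 * rate alpha beta n)%:E)%E /\
    (ereal_sup [set integrated_risk z K Kt (h n) n fV.1 fV.2
               | fV in lipschitz_class alpha Mf `*` variance_class beta MV]
      <= (C0 * rate alpha beta n)%:E)%E.
Proof.
pose kap := 1 + `|kK| + `|khat|.
pose C1 := 81 / 4 * Mf ^+ 4 + 36 * MV ^+ 2 + MV ^+ 2 * (c2 `^ beta) ^+ 2.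
pose C2 := 5 / 2 * (8 * (3 * Mf) ^+ 2 * MV + 2 * `|m4| * MV ^+ 2 + 4 * MV ^+ 2).
have kap1 : 1 <= kap by have := normr_ge0 kK; have := normr_ge0 khat; rewrite /kap; lra.
have C10 : 0 < C1.
  have := exprn_gt0 4 hMf; have := exprn_gt0 2 hMV.
  have : 0 <= MV ^+ 2 * (c2 `^ beta) ^+ 2 by rewrite mulr_ge0 ?sqr_ge0.
  by rewrite /C1; lra.
have C20 : 0 < C2.
  apply: mulr_gt0; first by rewrite divr_gt0.
  apply: ltr_wpDl; last by rewrite mulr_gt0 ?exprn_gt0.
  by apply: addr_ge0; rewrite !mulr_ge0 ?sqr_ge0 ?(ltW hMV) ?(ltW hMf).
have C00 : 0 < 2 * (3 * ((kap + 2) / 2) ^+ 2 * C1) + C2 * (2 * kap / c1).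
  have kap0 : 0 < kap := lt_le_trans ltr01 kap1.
  have L0 : 0 < (kap + 2) / 2 by rewrite divr_gt0// addr_gt0.
  have K0 : 0 < 2 * kap / c1 by rewrite divr_gt0// mulr_gt0.
  apply: addr_gt0; last exact: mulr_gt0.
  by apply: mulr_gt0 => //; apply: mulr_gt0 => //; rewrite mulr_gt0// exprn_gt0.
exists (2 * (3 * ((kap + 2) / 2) ^+ 2 * C1) + C2 * (2 * kap / c1)) => //.
(* The constant is fixed before the kernels, the bandwidths and the noise; two observations, hence
   one difference, already suffice for the bounds. *)
move=> K Kt h hK hKt h012 hh; exists 2%N => // n /= n2 d T P z nz.
have n0 : (0 < n)%N by exact: leq_trans n2.
set C0 := _ + _ in C00 *.
have prC f V : lipschitz_class alpha Mf f -> variance_class beta MV V ->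
    forall x, x \in `[0, 1] ->
    (pointwise_risk z K Kt (h n) n f V x <= (C0 * rate alpha beta n)%:E)%E.
  move=> hf hV x xI.
  have hD i := @mean_increment R alpha Mf halpha hMf n n2 f hf i.
  have hVb i : (1 <= i <= n)%N -> 0 <= V (design R n i) <= MV.
    by move=> /andP[_ iN]; apply: (variance_class_bound hbeta hV);
      exact: (design01 R n2).
  apply: (le_trans (pointwise_risk_le nz n2 K Kt (h n) x hD hVb)).
  rewrite lee_fin [leRHS]mulrDl; apply: lerD.
    have := bias_bound halpha hbeta hMf hMV n2 (h012 n n0) hK hKt (hh n n0) hf hV xI.
    rewrite -/kap -/C1; lra.
  have D0 : 0 <= 3 * Mf * n%:R `^ (- Num.min alpha 1).
    by rewrite !mulr_ge0 ?powR_ge0 ?(ltW hMf).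
  rewrite -[leRHS]mulrA; apply: ler_pM.
  - apply: mulr_ge0; first by rewrite divr_ge0.
    apply: addr_ge0; last by apply: mulr_ge0 (sqr_ge0 _).
    apply: addr_ge0; last by apply: mulr_ge0 (sqr_ge0 _); exact: mulr_ge0.
    by apply: mulr_ge0 (ltW hMV); apply: mulr_ge0 (sqr_ge0 _).
  - by apply: sumr_ge0 => i _; exact: sqr_ge0.
  (* In the variance the increments of [f] need only be bounded: $n^{-\min(\alpha,1)}\le1$ replaces
     $D_f$ by $3M_f$. *)
  - rewrite ler_wpM2l// !lerD2r ler_wpM2r ?(ltW hMV)// ler_wpM2l//.
    rewrite lerXn2r ?nnegrE ?mulr_ge0 ?(ltW hMf)// ler_piMr ?mulr_ge0 ?(ltW hMf)//.
    rewrite powRN invf_le1 ?powR_gt0 ?ltr0n// -[leLHS](powRr0 n%:R).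
    apply: ler_powR; first by rewrite ler1n.
    by rewrite le_min (ltW halpha) ler01.
  - exact: (weight_sqr_bound alpha hbeta hc1 n2 (h012 n n0) hK hKt (hh n n0) xI).
split; apply: ge_ereal_sup => _ [[f V] /= [hf hV] <-].
  apply: ge_ereal_sup => _ [x xI <-]; exact: prC.
have mV : measurable_fun (`[0, 1]%classic : set R) V.
  apply: subspace_continuous_measurable_fun => //.
  by have [VL _ _] := hV; exact: lipschitz_class_continuous VL.
apply: (integrated_risk_le n2 _ (h012 n n0) hK hKt mV) => //.
  by rewrite mulr_ge0 ?rate_ge0// ltW.
exact: prC.
Qed.
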